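(* Let $\mathcal I=\mathbb E\big[q^{(k)}_k(\omega)\big]$ be the information efficiency of state prices in the equilibrium $W^*$ with scale $\alpha^*$, where $s_k$ is the realized signal and $q^{(k)}(\omega)=(\pi_1^*(s_1\mid\omega),\dots,\pi_1^*(s_K\mid\omega))$ is the market maker's equilibrium posterior given order flow $\omega$, the expectation being over equilibrium order flow conditional on $s_k$. (i) $\mathcal I$ depends only on the number of possible signals $K=|S|$. (ii) In particular, $\mathcal I$ is invariant to the possible payoff distributions $\eta(\cdot\mid\cdot)$ and the noise-trade intensities $(\sigma_i)$.
   Context: Trading game. $X=\{x_1,x_2,\dots\}$ is a countable (finite or infinite) set of states; $S=\{s_1,\dots,s_K\}$ with uniform prior; for each $k$, $\eta(\cdot\mid s_k)$ is a probability mass function on $X$. $\sigma_i>0$; noise trades $\varepsilon_i\sim\mathcal N(0,\sigma_i^2)$ are independent. Equilibrium. $\mathbf Q=\mathbf I-\frac1K\bar e\bar e^T$, $\bar e=(1,\dots,1)^T\in\mathbb R^K$. $\mathbf L$ is the symmetric positive-semidefinite $K\times K$ matrix with $\mathbf L^2=\big[\sum_i\eta(x_i\mid s_k)\eta(x_i\mid s_l)/\sigma_i^2\big]_{k,l}$ (entries assumed finite; $\mathbf L^{-1}$ is the Moore–Penrose pseudoinverse if $\mathbf L$ is singular). The constant $\alpha^*=\alpha^*(K)>0$ is such that $\alpha^*\mathbf Q$ is an equilibrium of the canonical game with $K$ signals (described below; it involves only $K$). The equilibrium informed demand in the trading game is $W^*(\cdot\mid s_k)=\sum_l\beta^{(k)}_l\eta(\cdot\mid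 s_l)$, with $\beta^{(k)}$ the $k$-th column of $\alpha^*\mathbf L^{-1}\mathbf Q$. Conditional on $s_k$, equilibrium order flow is $\omega_i=W^*(x_i\mid s_k)+\varepsilon_i$, and the market maker's equilibrium posterior is $$\pi_1^*(s_l\mid\omega)\propto\exp\Big(\sum_i\tfrac{W^*(x_i\mid s_l)\omega_i}{\sigma_i^2}-\tfrac12\sum_i\tfrac{W^*(x_i\mid s_l)^2}{\sigma_i^2}\Big).$$ Canonical game. Conditional on signal $k$ (uniform prior), the insider submits $\hat d\in\mathbb R^K$; order flow is $\hat\omega=\hat d+\widehat N$, $\widehat N\sim\mathcal N(0,\mathbf I_K)$. Given belief $\widehat D=[\hat d^{(1)}\cdots\hat d^{(K)}]$, prices are $\hat\pi_1(l\mid\hat\omega;\widehat D)\propto e^{(\hat d^{(l)})^T\hat\omega-\frac12(\hat d^{(l)})^T\hat d^{(l)}}$, and the insider maximizes $J(\hat d\mid k;\widehat D)=\hat d_k-\mathbb E[\hat\pi_1(\cdot\mid\hat\omega;\widehat D)]^T\hat d$. An equilibrium is $D^*=[\delta^{(1)}\cdots\delta^{(K)}]$ with $\delta^{(k)}\in\arg\max_{\hat d}J(\hat d\mid k;D^* )$ for each $k$.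
   Formalization: The matrix L is assumed nonsingular (the payoff distributions given the K signals are linearly independent); for singular L the claim fails, e.g. K=2 with identical distributions gives efficiency 1/2, while disjoint supports give more. *)

(* Defs.v *)
From HB Require Import structures.
From mathcomp Require Import all_boot all_order all_algebra.
From mathcomp Require Import all_classical all_reals all_analysis.

Set Implicit Arguments.
Unset Strict Implicit.
Unset Printing Implicit Defensive.

Import Order.TTheory GRing.Theory Num.Theory.
Import numFieldNormedType.Exports.

Local Open Scope classical_set_scope.
Local Open Scope ring_scope.

(* A countable set X = {x_1, x_2, ...} is a [countType], finite or infinite,
   enumerated by [pickle]; indices outside the range of [pickle] contribute 0.
   All sums over X, including the random series in the market maker's
   posterior, are limits of partial sums along this enumeration. *)
Definition psum (R : realType) (X : countType) (f : X -> R) (n : nat) : R :=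
  \sum_(0 <= i < n) oapp f 0 (@pickle_inv X i).

Definition csum (R : realType) (X : countType) (f : X -> R) : R :=
  limn (psum f).

Definition mutually_independent (R : realType) (d : measure_display)
    (Omega : measurableType d) (P : probability Omega R) (I : eqType)
    (Y : I -> {RV P >-> R}) : Prop :=
  forall (s : seq I) (A : I -> set R), uniq s ->
    (forall i, measurable (A i)) ->
    P (\bigcap_(i in [set` s]) (Y i @^-1` A i)) =
    (\prod_(i <- s) P (Y i @^-1` A i))%E.

Definition gaussian_noise (R : realType) (d : measure_display)
    (Omega : measurableType d) (P : probability Omega R) (I : eqType)
    (sigma : I -> R) (Y : I -> {RV P >-> R}) : Prop :=
  mutually_independent Y /\
  forall (i : I) (A : set R), measurable A ->
    distribution P (Y i) A = normal_prob 0 (sigma i) A.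

Definition normalized_exp (R : realType) (K : nat) (z : 'I_K -> R) (l : 'I_K)
    : R :=
  expR (z l) / \sum_(m < K) expR (z m).

Definition Qmx (R : realType) (K : nat) : 'M[R]_K :=
  1%:M - K%:R^-1 *: const_mx 1.

(* In the canonical game a belief is the matrix D whose l-th column is the
   demand attributed to signal l. *)
Definition canonical_price (R : realType) (K : nat) (D : 'M[R]_K)
    (w : 'cV[R]_K) : 'I_K -> R :=
  normalized_exp (fun l =>
    ((col l D)^T *m w) 0 0 - 2^-1 * ((col l D)^T *m col l D) 0 0).

Definition canonical_payoff (R : realType) (K : nat) (d : measure_display)
    (Omega : measurableType d) (P : probability Omega R)
    (N : 'I_K -> {RV P >-> R}) (D : 'M[R]_K) (k : 'I_K) (x : 'cV[R]_K) : R :=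
  x k 0 -
  \sum_(l < K)
    fine 'E_P[fun t => canonical_price D (x + \col_j N j t) l] * x l 0.

Definition canonical_equilibrium (R : realType) (K : nat) (d : measure_display)
    (Omega : measurableType d) (P : probability Omega R)
    (N : 'I_K -> {RV P >-> R}) (D : 'M[R]_K) : Prop :=
  forall (k : 'I_K) (x : 'cV[R]_K),
    canonical_payoff N D k x <= canonical_payoff N D k (col k D).

(* The payoff depends on N only through its law N(0, I_K), so the choice of the
   probability space carrying the noise is immaterial. *)
Definition canonical_scale (R : realType) (K : nat) (a : R) : Prop :=
  0 < a /\
  exists (d : measure_display) (Omega : measurableType d)
         (P : probability Omega R) (N : 'I_K -> {RV P >-> R}),
    gaussian_noise (fun _ => 1) N /\ canonical_equilibrium N (a *: Qmx R K).

Record trading_game (R : realType) (K : nat) := TradingGame {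
  state : countType;
  eta : 'I_K -> state -> R;
  sigma : state -> R;
  eta_ge0 : forall k x, 0 <= eta k x;
  eta_sum1 : forall k, psum (eta k) @ \oo --> (1 : R);
  sigma_gt0 : forall x, 0 < sigma x;
  gram_finite : forall k l,
    cvgn (psum (fun x => eta k x * eta l x / sigma x ^+ 2))
}.

Definition gram (R : realType) (K : nat) (G : trading_game R K) : 'M[R]_K :=
  \matrix_(k, l) csum (fun x : state G => eta k x * eta l x / sigma x ^+ 2).

Definition psd_sqrt (R : realType) (K : nat) (A L : 'M[R]_K) : Prop :=
  [/\ L^T = L, forall v : 'cV[R]_K, 0 <= (v^T *m L *m v) 0 0 & L *m L = A].

Definition moore_penrose (R : realType) (K : nat) (L Lp : 'M[R]_K) : Prop :=
  [/\ L *m Lp *m L = L, Lp *m L *m Lp = Lp,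
      (L *m Lp)^T = L *m Lp & (Lp *m L)^T = Lp *m L].

(* For l, m, the sum of W(x | l) W(x | m) / sigma(x)^2 over x is the (l, m) entry
   of a^2 Q E Q, with E = L Lp the orthogonal projection onto the range of L.
   Since gram G does not annihilate (1, ..., 1), this matrix equals a^2 Q if and
   only if L is nonsingular. *)
Definition informed_demand (R : realType) (K : nat) (G : trading_game R K)
    (a : R) (Lp : 'M[R]_K) (k : 'I_K) (x : state G) : R :=
  \sum_(l < K) (a *: (Lp *m Qmx R K)) l k * eta l x.

Definition market_posterior (R : realType) (K : nat) (G : trading_game R K)
    (a : R) (Lp : 'M[R]_K) (w : state G -> R) : 'I_K -> R :=
  normalized_exp (fun l =>
    csum (fun x => informed_demand a Lp l x * w x / sigma x ^+ 2) -
    2^-1 * csum (fun x : state G =>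
                   informed_demand a Lp l x ^+ 2 / sigma x ^+ 2)).

Definition info_efficiency (R : realType) (K : nat) (G : trading_game R K)
    (a : R) (Lp : 'M[R]_K) (d : measure_display) (Omega : measurableType d)
    (P : probability Omega R) (eps : state G -> {RV P >-> R}) (k : 'I_K)
    : \bar R :=
  'E_P[fun t =>
    market_posterior a Lp (fun x => informed_demand a Lp k x + eps x t) k].

(* Main.v *)
(* Since [Lp] is the inverse of [L], the demands [W l] have, in the inner product
   weighted by [1 / sigma ^+ 2], the Gram matrix [a ^+ 2 *: Q], whatever the game.
   Under signal [k] the log-weights of the posterior are therefore Gaussian with
   mean and covariance that only depend on [a], [K] and [k], and the dependence on
   [k] is removed by permuting the coordinates.

   The law of the noise enters only through expectations of cosines of linear
   forms.  They give the almost sure convergence of the noise series (a maximal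
   inequality for stopped sums) and the expectation of the cosine of any linear
   form of the log-weights.  The functions whose expectation is determined by the
   latter form an algebra closed under bounded pointwise limits, which contains
   the softmax function: [softmax y] is the limit of [softmax (n * sin (y / n))],
   and the latter is obtained from the exponential and the geometric series. *)

Require Import Defs.
From HB Require Import structures.
From mathcomp Require Import all_boot all_order all_algebra perm.
From mathcomp Require Import ring lra.
From mathcomp Require Import all_classical all_reals all_analysis.
From mathcomp Require Import measurable_realfun lebesgue_integral_under.

Local Open Scope ring_scope.

Set Implicit Arguments.
Unset Strict Implicit.
Unset Printing Implicit Defensive.
Import Order.TTheory GRing.Theory Num.Theory.
Import numFieldNormedType.Exports.

(** * Fourier transform of the normal law *)

(** Independence is used only through integrals of products of bounded functions, so no
    integrability of the noise or of the log-weights has to be known beforehand. The free phase [c]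
    in [cos (r * x + c)] lets one family of real functions carry the sines too (phase [- (pi / 2)]),
    in the role of complex exponentials. The two games live on different probability spaces and are
    compared through integrals alone; their joint laws are never built. Two obstacles shape the
    argument. The log-weights are infinite series, with a default value where they diverge:
    measurability of the limit and almost sure convergence must both be settled before an
    expectation can pass to the limit. And their coordinates are unbounded, so the partial sums of a
    power series in them have no common bound. The bounded substitute [n * sin (y / n)] restores one
    for each fixed [n]; the final limit in [n] is dominated because softmax takes its values in
    [0, 1]. *)

Section bounded_integral.
Local Open Scope classical_set_scope.
Context d (T : measurableType d) (R : realType).

Lemma bounded_integrable (P : {finite_measure set T -> \bar R}) (f : T -> R) (M : R) :
  measurable_fun setT f -> (forall x, `|f x| <= M) ->
  P.-integrable setT (EFin \o f).
Proof.
move=> mf fM; apply: measurable_bounded_integrable => //.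
  by rewrite ltey_eq fin_num_measure.
exists M; split; first exact: num_real.
by move=> x Mx t _ /=; rewrite (le_trans (fM t))// ltW.
Qed.

Lemma Rintegral_bounded_cvg (P : {finite_measure set T -> \bar R})
    (f_ : nat -> T -> R) (f : T -> R) (M : R) :
  (forall n, measurable_fun setT (f_ n)) -> measurable_fun setT f ->
  (forall n x, `|f_ n x| <= M) ->
  {ae P, forall x, f_ ^~ x @ \oo --> f x} ->
  (\int[P]_x f_ n x)%R @[n --> \oo] --> (\int[P]_x f x)%R.
Proof.
move=> mf_ mf fM ff.
have [intf _ cv] : [/\ P.-integrable setT (EFin \o f),
    [sequence \int[P]_x `|(f_ n x)%:E - (f x)%:E|]_n @ \oo --> 0 &
    [sequence \int[P]_x (f_ n x)%:E]_n @ \oo --> \int[P]_x (f x)%:E]%E.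
  apply: (@dominated_convergence _ _ _ P setT measurableT
    (fun n => EFin \o f_ n) (EFin \o f) (fun=> M%:E)).
  - by move=> n; exact/measurable_EFinP.
  - exact/measurable_EFinP.
  - by apply: filterS ff => x fx _; apply: cvg_EFin => //; exact: nearW.
  - by apply: (@bounded_integrable P _ `|M|).
  - by apply: aeW => x n _; rewrite lee_fin.
apply: fine_cvg; rewrite fineK//.
exact: integrable_fin_num.
Qed.

Lemma Rintegral_probability_cst (P : probability T R) (r : R) : (\int[P]_t r = r)%R.
Proof.
rewrite (Rintegral_cst P measurableT r).
rewrite [X in fine X](_ : _ = 1%E) ?mulr1//.
exact: probability_setT.
Qed.

End bounded_integral.

Section normal_law.
Local Open Scope classical_set_scope.
Context {R : realType}.
Local Open Scope charge_scope.
Notation mu := (@lebesgue_measure R).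

(** The Radon-Nikodym derivative of the normal law and [normal_pdf] have the same integral over
    every measurable set, hence agree almost everywhere. *)
Lemma integral_normal_prob (m s : R) (f : R -> R) (M : R) :
  measurable_fun setT f -> (forall x, `|f x| <= M) ->
  (\int[normal_prob m s]_x f x = \int[mu]_x (f x * normal_pdf m s x))%R.
Proof.
move=> mf fM; rewrite /Rintegral; congr fine.
have nmu := normal_prob_dominates m s.
pose nu : {charge set _ -> \bar R} := charge_of_finite_measure (normal_prob m s).
have numu : nu `<< mu by exact: nmu.
rewrite -(Radon_Nikodym_change_of_variables nmu measurableT); last first.
  exact: (@bounded_integrable _ _ _ (normal_prob m s) _ _ mf fM).
have ip := integrable_normal_pdf m s.
apply: ae_eq_integral => //.
- apply: emeasurable_funM; first exact/measurable_EFinP.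
  exact: (measurable_int _ (Radon_Nikodym_integrable numu)).
- apply/measurable_EFinP/measurable_funM => //; exact: measurable_normal_pdf.
have H : ae_eq mu setT ('d nu '/d mu) (fun x => (normal_pdf m s x)%:E).
  apply: integral_ae_eq => //.
  - exact: (Radon_Nikodym_integrable numu).
  - exact: (measurable_int _ ip).
  - by move=> E _ mE; rewrite -(Radon_Nikodym_integral numu mE).
by apply: filterS H => x H _; rewrite H// EFinM.
Qed.

(** The fundamental theorem of calculus on growing symmetric intervals leaves boundary terms that
    tend to 0; dominated convergence identifies the limit of the integrals. This is what integration
    by parts needs below. *)
Lemma Rintegral_derive_eq0 (F f : R -> R) :
  (forall x : R, is_derive x 1 F (f x)) -> continuous f ->
  mu.-integrable setT (EFin \o f) ->
  F n%:R @[n --> \oo] --> 0 -> F (- n%:R) @[n --> \oo] --> 0 ->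
  (\int[mu]_x f x = 0)%R.
Proof.
move=> dF cf intf F0 F1.
have mf : measurable_fun setT f by exact: continuous_measurable_fun.
(* The endpoints use [n.+1] so that the interval is never degenerate. *)
have E n : (\int[mu]_(x in `[(- n.+1%:R)%R, n.+1%:R]) f x
            = F n.+1%:R - F (- n.+1%:R))%R.
  rewrite /Rintegral (@continuous_FTC2 _ f F)//.
  - by rewrite (@lt_trans _ _ 0)// ltrNl oppr0.
  - by apply: continuous_subspaceT.
  - split.
    + by move=> x _; exact: (@ex_derive _ _ _ _ _ _ _ (dF x)).
    + apply: cvg_at_right_filter; apply: differentiable_continuous.
      by apply/derivable1_diffP; exact: (@ex_derive _ _ _ _ _ _ _ (dF _)).
    + apply: cvg_at_left_filter; apply: differentiable_continuous.
      by apply/derivable1_diffP; exact: (@ex_derive _ _ _ _ _ _ _ (dF _)).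
  - by move=> x _; rewrite derive1E (@derive_val _ _ _ _ _ _ _ (dF x)).
have L1 : (\int[mu]_(x in `[(- n.+1%:R)%R, n.+1%:R]) f x)%R @[n --> \oo] --> 0.
  under eq_fun do rewrite E.
  rewrite -[0]subr0; apply: cvgB.
    by have := F0; rewrite -(cvg_shiftS (fun n => F n%:R)).
  by have := F1; rewrite -(cvg_shiftS (fun n => F (- n%:R))).
have L2 : (\int[mu]_(x in `[(- n.+1%:R)%R, n.+1%:R]) f x)%R @[n --> \oo]
    --> (\int[mu]_x f x)%R.
  have mn n : measurable_fun setT ((EFin \o f) \_ `[(- n.+1%:R)%R, n.+1%:R]).
    apply/(measurable_restrictT _ _).1 => //.
    by apply/measurable_EFinP; apply: measurable_funS mf.
  have [_ _ cv] : [/\ mu.-integrable setT (EFin \o f),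
    [sequence \int[mu]_x `|((EFin \o f) \_ `[(- n.+1%:R)%R, n.+1%:R]) x - (f x)%:E|]_n @ \oo --> 0 &
    [sequence \int[mu]_x ((EFin \o f) \_ `[(- n.+1%:R)%R, n.+1%:R]) x]_n @ \oo --> \int[mu]_x (f x)%:E]%E.
    apply: (@dominated_convergence _ _ _ mu setT measurableT _ _
      (fun x => `|(f x)%:E|%E)) => //.
    - exact/measurable_EFinP.
    - apply: aeW => x _; apply: cvg_near_cst; near=> n.
      rewrite /restrict ifT// mem_setE in_itv/= -ler_norml.
      near: n; exists (Num.truncn `|x|) => // n /= Hn.
      by rewrite (le_trans (ltW (truncnS_gt _)))// ler_nat ltnS.
    - exact: integrable_abse.
    - apply: aeW => x n _; rewrite /restrict.
      by case: ifPn => // _; rewrite abse0.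
  rewrite /Rintegral; apply: fine_cvg; rewrite fineK; last exact: integrable_fin_num.
  apply: cvg_trans cv; apply: near_eq_cvg; apply: nearW => n.
  by rewrite [RHS]integral_mkcond.
exact: (cvg_unique _ L2 L1).
Unshelve. all: end_near. Qed.
End normal_law.

Section derive_facts.
Context {R : realType}.

Lemma is_derive_affine (b c x : R) : is_derive x 1 (fun y : R => b * y + c) b.
Proof.
have -> : (fun y : R => b * y + c) = b \*: (@id R) + cst c by [].
apply: is_derive_eq.
by rewrite addr0 /GRing.scale/= mulr1.
Qed.

Lemma is_derive_sin_affine (b c x : R) :
  is_derive x 1 (fun y : R => sin (b * y + c)) (b * cos (b * x + c)).
Proof.
rewrite mulrC; have H := is_derive_affine b c x.
exact: (@is_derive1_comp _ (@sin R) (fun y => b * y + c)).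
Qed.

Lemma is_derive_cos_affine (b c x : R) :
  is_derive x 1 (fun y : R => cos (b * y + c)) (- (b * sin (b * x + c))).
Proof.
rewrite mulrC -mulNr; have H := is_derive_affine b c x.
exact: (@is_derive1_comp _ (@cos R) (fun y => b * y + c)).
Qed.

Lemma is_derive_expR_sqr (k x : R) :
  is_derive x 1 (fun y : R => expR (k * y ^+ 2)) (2 * k * x * expR (k * x ^+ 2)).
Proof.
have H : is_derive x 1 (fun y : R => k * y ^+ 2) (2 * k * x).
  have -> : (fun y : R => k * y ^+ 2) = k \*: ((@id R) ^+ 2) by [].
  apply: is_derive_eq.
  by rewrite /GRing.scale/= expr1; ring.
rewrite mulrC; exact: (@is_derive1_comp _ (@expR R) (fun y => k * y ^+ 2)).
Qed.

End derive_facts.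
Section normal_char.
Local Open Scope classical_set_scope.
Context {R : realType}.
Notation mu := (@lebesgue_measure R).
Variable s : R.
Hypothesis s0 : 0 < s.
Let g := normal_pdf 0 s.

Let gE x : g x = normal_peak s * expR (- (2^-1 * (x / s) ^+ 2)).
Proof.
rewrite /g normal_pdfE ?gt_eqF// /normal_fun subr0; congr (_ * expR _).
rewrite mulNr expr_div_n -mulr_natl invfM; congr (- _).
by rewrite mulrCA mulrA mulrAC mulrA.
Qed.

Let gE2 x : g x = normal_peak s * expR (- (2^-1 / s ^+ 2) * x ^+ 2).
Proof. by rewrite gE; congr (_ * expR _); field; rewrite gt_eqF. Qed.

Let dg (x : R) : is_derive x 1 g (- (x / s ^+ 2) * g x).
Proof.
have -> : g = normal_peak s \*: (fun y => expR (- (2^-1 / s ^+ 2) * y ^+ 2)).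
  by apply/funext => y; exact: gE2.
have := is_derive_expR_sqr (- (2^-1 / s ^+ 2)) x => H.
apply: is_derive_eq => /=.
by rewrite /GRing.scale/=; field; rewrite gt_eqF.
Qed.

(** Half of the exponent is spent on the factor |x|: with y = |x| / s, y <= 1 + y^2 / 4 <= exp (y^2
    / 4), the first inequality being (y / 2 - 1)^2 >= 0. The other half is the Gaussian profile of
    deviation s sqrt 2, and the quotient of peaks turns it into a density, which is integrable and
    bounded. *)
Lemma normr_normal_pdf_le (x : R) : `|x| * g x <=
  s * normal_peak s / normal_peak (s * Num.sqrt 2) * normal_pdf 0 (s * Num.sqrt 2) x.
Proof.
have q0 : 0 < s * Num.sqrt 2 by rewrite mulr_gt0// sqrtr_gt0.
rewrite normal_pdfE ?gt_eqF//= mulrA divfK ?gt_eqF ?normal_peak_gt0 ?gt_eqF//.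
rewrite gE mulrCA mulrA -(mulrA (normal_peak s)) -(mulrC (normal_peak s)) -mulrA.
rewrite ler_pM2l ?normal_peak_gt0 ?gt_eqF//.
have -> : normal_fun 0 (s * Num.sqrt 2) x = expR (- (4^-1 * (x / s) ^+ 2)).
  rewrite /normal_fun subr0 mulNr; congr (expR (- _)).
  by rewrite exprMn sqr_sqrtr//; field; rewrite gt_eqF.
have -> : - (2^-1 * (x / s) ^+ 2) = - (4^-1 * (x / s) ^+ 2) - (4^-1 * (x / s) ^+ 2) by field; rewrite gt_eqF.
rewrite expRD mulrA mulrAC ler_pM2r ?expR_gt0//.
rewrite expRN ler_pdivrMr ?expR_gt0//.
apply: (@le_trans _ _ (s * (1 + 4^-1 * (x / s) ^+ 2))).
  rewrite -(ger0_norm (ltW s0)) -ler_pdivrMl ?normr_gt0 ?gt_eqF// (ger0_norm (ltW s0)).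
  have -> : s^-1 * `|x| = `|x / s| by rewrite normrM normfV (ger0_norm (ltW s0)) mulrC.
  rewrite -(real_normK (num_real (x / s))).
  have := sqr_ge0 (`|x / s| / 2 - 1); nra.
by rewrite ler_pM2l// expR_ge1Dx.
Qed.

Let mg : measurable_fun setT g. Proof. exact: measurable_normal_pdf. Qed.
Let g0 x : 0 <= g x. Proof. exact: normal_pdf_ge0. Qed.
Let cg : continuous g. Proof. by apply: continuous_normal_pdf; rewrite gt_eqF. Qed.
Let intg : mu.-integrable setT (EFin \o g).
Proof. exact: integrable_normal_pdf. Qed.

Let intxg : mu.-integrable setT (EFin \o (fun x => `|x| * g x)).
Proof.
set K := s * normal_peak s / normal_peak (s * Num.sqrt 2).
have iK : mu.-integrable setT
    (fun x => (K%:E * (normal_pdf 0 (s * Num.sqrt 2) x)%:E)%E).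
  by apply: integrableZl => //; exact: integrable_normal_pdf.
apply: (le_integrable _ _ _ iK) => //.
  by apply/measurable_EFinP; apply: measurable_funM => //; exact: measurableT_comp.
move=> x _ /=; rewrite lee_fin (ger0_norm (mulr_ge0 (normr_ge0 x) (g0 x))).
by rewrite (le_trans (normr_normal_pdf_le x))// ler_norm.
Qed.

Let int_le_xg (f : R -> R) (K : R) : measurable_fun setT f ->
  (forall x, `|f x| <= K * (`|x| * g x)) -> mu.-integrable setT (EFin \o f).
Proof.
move=> mf fK; apply: (le_integrable _ _ _ (integrableZl measurableT K intxg)) => //.
  exact/measurable_EFinP.
by move=> x _ /=; rewrite lee_fin (le_trans (fK x))// ler_norm.
Qed.

Let int_le_g (f : R -> R) (K : R) : measurable_fun setT f ->
  (forall x, `|f x| <= K * g x) -> mu.-integrable setT (EFin \o f).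
Proof.
move=> mf fK; apply: (le_integrable _ _ _ (integrableZl measurableT K intg)) => //.
  exact/measurable_EFinP.
by move=> x _ /=; rewrite lee_fin (le_trans (fK x))// ler_norm.
Qed.

(** Since |x| g x is bounded, g decays at least like 1 / n along [u]; this kills the boundary terms
    of the integration by parts. *)
Let g_cvg0 (u : nat -> R) : (forall n, `|u n| = n%:R) -> g (u n) @[n --> \oo] --> 0.
Proof.
move=> un.
set K := s * normal_peak s / normal_peak (s * Num.sqrt 2) * normal_peak (s * Num.sqrt 2).
have gK n : g (u n.+1) <= K * n.+1%:R^-1.
  rewrite ler_pdivlMr// mulrC -un (le_trans (normr_normal_pdf_le _))//.
  rewrite ler_wpM2l//.
    by rewrite !mulr_ge0 ?invr_ge0 ?normal_peak_ge0// ltW.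
  by rewrite normal_pdf_ub// gt_eqF// mulr_gt0// sqrtr_gt0.
rewrite -(cvg_shiftS (fun n => g (u n))).
apply: (@squeeze_cvgr _ _ _ _ (cst 0) (fun n => K * n.+1%:R^-1)).
- by apply: nearW => n; rewrite g0 gK.
- exact: cvg_cst.
- rewrite -(mulr0 K); apply: cvgMr; exact: cvg_harmonic.
Qed.

Let mtrig (h : R -> R) (b c : R) : continuous h ->
  measurable_fun setT (fun x => h (b * x + c)).
Proof.
move=> ch; apply: measurableT_comp; first exact: continuous_measurable_fun.
by apply: measurable_funD => //; exact: measurable_funM.
Qed.

(** The difference of the two sides is the integral of the derivative of [sin (b * x + c) * g x]. *)
Let ibp (b c : R) : (b * \int[mu]_x (cos (b * x + c) * g x) =
  s ^- 2 * \int[mu]_x (x * sin (b * x + c) * g x))%R.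
Proof.
have mc := mtrig b c (@continuous_cos R).
have ms := mtrig b c (@continuous_sin R).
have i1 : mu.-integrable setT (EFin \o (fun x => cos (b * x + c) * g x)).
  apply: (@int_le_g _ 1); first exact: measurable_funM.
  move=> x; rewrite normrM (ger0_norm (g0 x)) ler_wpM2r//; exact: cos_max.
have i2 : mu.-integrable setT (EFin \o (fun x => x * sin (b * x + c) * g x)).
  apply: (@int_le_xg _ 1).
    by apply: measurable_funM => //; exact: measurable_funM.
  move=> x; rewrite !normrM (ger0_norm (g0 x)) mulrAC [leRHS]mulrC ler_wpM2l ?mulr_ge0//; exact: sin_max.
apply/eqP; rewrite -subr_eq0 -!RintegralZl//.
rewrite -RintegralB//=; last 2 first.
  by have := integrableZl measurableT b i1.
  by have := integrableZl measurableT (s ^- 2) i2.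
apply/eqP.
apply: (@Rintegral_derive_eq0 _ (fun x => sin (b * x + c) * g x)).
- move=> x.
  have H1 := is_derive_sin_affine b c x.
  have H2 := dg x.
  have -> : (fun x => sin (b * x + c) * g x) = (fun x => sin (b * x + c)) * g by [].
  apply: is_derive_eq; rewrite /GRing.scale/=; field; by rewrite gt_eqF.
- move=> x; apply: cvgB; (apply: cvgMr; apply: cvgM; last exact: cg).
    apply: (@continuous_comp _ _ _ (fun x => b * x + c) cos); last exact: continuous_cos.
    apply: cvgD; last exact: cvg_cst. apply: cvgMr. exact: cvg_id.
  apply: cvgM; first exact: cvg_id.
  apply: (@continuous_comp _ _ _ (fun x => b * x + c) sin); last exact: continuous_sin.
  apply: cvgD; last exact: cvg_cst. apply: cvgMr. exact: cvg_id.
- apply: (integrableB _ (integrableZl measurableT b i1) (integrableZl measurableT (s ^- 2) i2)) => //.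
- apply: norm_cvg0.
  apply: (@squeeze_cvgr _ _ _ _ (cst 0) (fun n => g n%:R)).
  + apply: nearW => n; rewrite normr_ge0 normrM (ger0_norm (g0 _)) ler_piMl//; exact: sin_max.
  + exact: cvg_cst.
  + by apply: g_cvg0 => n; rewrite ger0_norm.
- apply: norm_cvg0.
  apply: (@squeeze_cvgr _ _ _ _ (cst 0) (fun n => g (- n%:R))).
  + apply: nearW => n; rewrite normr_ge0 normrM (ger0_norm (g0 _)) ler_piMl//; exact: sin_max.
  + exact: cvg_cst.
  + by apply: g_cvg0 => n; rewrite normrN ger0_norm.
Qed.

(** Differentiation under the integral: the derivative in [b] of the integrand is dominated by
    [|x| * g x], uniformly in [b], so the radius 1 of the neighbourhood is arbitrary. *)
Let deriv (b c : R) : is_derive b 1 (fun b => (\int[mu]_x (cos (b * x + c) * g x))%R)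
   (- (\int[mu]_x (x * sin (b * x + c) * g x))%R).
Proof.
pose f := fun (b x : R) => cos (b * x + c) * g x.
have df (y b' : R) : is_derive b' 1 (f ^~ y) (- (y * sin (b' * y + c) * g y)).
  have H := is_derive_cos_affine y c b'.
  have -> : f ^~ y = g y \*: (fun b => cos (y * b + c)).
    by apply/funext => z; rewrite /f /= mulrC [in cos _](mulrC z).
  apply: is_derive_eq; rewrite /GRing.scale/= (mulrC b'); ring.
have iB : (`]b - 1, b + 1[%classic : set R) b by rewrite /= in_itv/= ltrBlDr ltrDl ltr01.
have If x : mu.-integrable setT (EFin \o f x).
  apply: (@int_le_g _ 1).
    by apply: measurable_funM => //; exact: mtrig (@continuous_cos R).
  move=> y; rewrite normrM (ger0_norm (g0 y)) ler_wpM2r//; exact: cos_max.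
have G0 x : 0 <= `|x| * g x by rewrite mulr_ge0.
have dfx x y : `]b - 1, b + 1[%classic x -> [set: R] y -> derivable (f ^~ y) x 1.
  by move=> _ _; exact: (@ex_derive _ _ _ _ _ _ _ (df _ _)).
have Gub x y : `]b - 1, b + 1[%classic x -> [set: R] y ->
    `|partial1of2 f x y| <= `|y| * g y.
  move=> _ _; rewrite partial1of2E (@derive_val _ _ _ _ _ _ _ (df _ _)).
  rewrite normrN !normrM (ger0_norm (g0 y)) mulrAC ler_piMr ?mulr_ge0//; exact: sin_max.
have If' x : `]b - 1, b + 1[%classic x -> mu.-integrable setT (EFin \o f x) by [].
apply: DeriveDef.
  exact: (derivable_under_integral measurableT iB If' dfx G0 intxg Gub).
rewrite -derive1E.
rewrite (differentiation_under_integral measurableT iB If' dfx G0 intxg Gub).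
rewrite -mulN1r -RintegralZl//; last first.
  apply: (@int_le_xg _ 1).
    apply: measurable_funM => //; apply: measurable_funM => //; exact: mtrig (@continuous_sin R).
  move=> x; rewrite !normrM (ger0_norm (g0 x)) mulrAC [leRHS]mulrC ler_wpM2l ?mulr_ge0//; exact: sin_max.
apply: eq_Rintegral => x _.
by rewrite partial1of2E (@derive_val _ _ _ _ _ _ _ (df _ _)) mulN1r.
Qed.

(* [F b = \int cos (b x + c) g x] solves [F' b = - s ^+ 2 * b * F b]: integrate by
   parts, using [g' x = - x / s ^+ 2 * g x]. *)
Lemma integral_cos_normal_prob (b c : R) :
  (\int[normal_prob 0 s]_x cos (b * x + c) =
   cos c * expR (- (b ^+ 2 * s ^+ 2 / 2)))%R.
Proof.
rewrite (@integral_normal_prob _ _ _ _ 1); last 2 first.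
- exact: mtrig (@continuous_cos R).
- by move=> x; exact: cos_max.
pose F b := (\int[mu]_x (cos (b * x + c) * g x))%R.
rewrite -/(F b).
(* Integrating factor of the differential equation: [F * E] has derivative 0, so it keeps its value
   [cos c] at 0. *)
pose E b := expR (2^-1 * s ^+ 2 * b ^+ 2).
have dFE (x : R) : is_derive x 1 (F * E) 0.
  have H1 : is_derive x 1 F (- (s ^+ 2 * (x * F x))).
    have := deriv x c; rewrite -/F.
    suff -> : (\int[mu]_y (y * sin (x * y + c) * g y) = s ^+ 2 * (x * F x))%R by [].
    by rewrite /F ibp mulrA divff ?mul1r// expf_neq0// gt_eqF.
  have H2 : is_derive x 1 E (2 * (2^-1 * s ^+ 2) * x * E x).
    exact: is_derive_expR_sqr.
  by apply: is_derive_eq; rewrite /GRing.scale/=; field.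
have : F b * E b = F 0 * E 0 by exact: (is_derive_0_is_cst b 0 dFE).
rewrite {2}/E expr0n/= mulr0 expR0 mulr1.
have -> : F 0 = cos c.
  rewrite /F; under eq_Rintegral do rewrite mul0r add0r.
  rewrite RintegralZl// /Rintegral integral_normal_pdf/= mulr1//.
move=> <-; rewrite /E -(mulrA (F b)) -expRD.
rewrite [X in expR X](_ : _ = 0) ?expR0 ?mulr1//; by field.
Qed.
End normal_char.

(** * Almost sure convergence of the noise series *)

Section independent_pair.
Local Open Scope classical_set_scope.
Context d (T : measurableType d) (R : realType) (P : probability T R).

Lemma Rintegral_distribution d' (T' : measurableType d') (X : {mfun T >-> T'})
    (f : T' -> R) (M : R) :
  measurable_fun setT f -> (forall x, `|f x| <= M) ->
  (\int[distribution P X]_y f y = \int[P]_t f (X t))%R.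
Proof.
move=> mf fM; rewrite /Rintegral (@integral_distribution _ _ _ _ _ P X (EFin \o f))//.
  exact/measurable_EFinP.
apply: (@bounded_integrable _ _ _ P (f \o X) M) => //.
  exact: measurableT_comp.
by move=> x; exact: fM.
Qed.

(** The product rule on rectangles forces the law of the pair to be the product of the two laws;
    Fubini's theorem then splits the integral. *)
Lemma Rintegral_independent_mul (X Y : {mfun T >-> R}) (h f : R -> R) (M N : R) :
  (forall A B, measurable A -> measurable B ->
    P (X @^-1` A `&` Y @^-1` B) = (P (X @^-1` A) * P (Y @^-1` B))%E) ->
  measurable_fun setT h -> (forall x, `|h x| <= M) ->
  measurable_fun setT f -> (forall x, `|f x| <= N) ->
  (\int[P]_t (h (X t) * f (Y t)) = \int[P]_t h (X t) * \int[P]_t f (Y t))%R.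
Proof.
move=> XY mh hM mf fN.
have mZ : measurable_fun setT (fun t => (X t, Y t)) by exact: measurable_fun_pair.
pose Z : {mfun T >-> (R * R)%type} :=
  HB.pack (fun t => (X t, Y t)) (isMeasurableFun.Build _ _ _ _ _ mZ).
pose m' := distribution P Z.
pose g (z : R * R) : \bar R := (h z.1 * f z.2)%:E.
have mg : measurable_fun setT g.
  apply/measurable_EFinP; apply: measurable_funM.
    by apply: measurableT_comp mh _.
  by apply: measurableT_comp mf _.
have gMN z : `|h z.1 * f z.2| <= M * N by rewrite normrM ler_pM.
have ig (Q : {finite_measure set (R * R)%type -> \bar R}) : Q.-integrable setT g.
  by apply: (@bounded_integrable _ _ _ Q (fun z => h z.1 * f z.2) (M * N)) => //; exact/measurable_EFinP.
rewrite -(Rintegral_distribution X mh hM) -(Rintegral_distribution Y mf fN).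
have ih : (distribution P X).-integrable setT (EFin \o h).
  exact: (@bounded_integrable _ _ _ (distribution P X) _ _ mh hM).
have if_ : (distribution P Y).-integrable setT (EFin \o f).
  exact: (@bounded_integrable _ _ _ (distribution P Y) _ _ mf fN).
apply: EFin_inj; rewrite EFinM !fineK; last 3 first.
- exact: integrable_fin_num.
- exact: integrable_fin_num.
- apply: integrable_fin_num => //.
  apply: (@bounded_integrable _ _ _ P (fun t => h (X t) * f (Y t)) (M * N)).
    by apply: measurable_funM; exact: measurableT_comp.
  by move=> t; exact: (gMN (Z t)).
transitivity (\int[m']_z g z)%E.
  rewrite integral_distribution//.
  apply: (@bounded_integrable _ _ _ P (fun t => h (X t) * f (Y t)) (M * N)).
    by apply: measurable_funM; exact: measurableT_comp.
  by move=> t; exact: (gMN (Z t)).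
transitivity (\int[(distribution P X \x distribution P Y)%E]_z g z)%E.
  apply: eq_measure_integral => A mA _.
  apply/esym; apply: product_measure_unique => //= B C mB mC.
rewrite -integral12_prod_meas1; last exact: (ig (product_subprobability
  (distribution P X : subprobability _ _, distribution P Y : subprobability _ _))).
rewrite /fubini_F/=.
have fy : (\int[distribution P Y]_y (f y)%:E)%E \is a fin_num by exact: integrable_fin_num.
rewrite -[X in _ = (_ * X)%E]fineK// -integralZr//.
apply: eq_integral => x _.
rewrite /g/= fineK//; under eq_integral do rewrite EFinM.
by rewrite integralZl.
Qed.

End independent_pair.

Section pickle_inv.
Variable X : countType.

Definition enum_prefix (n : nat) : seq X := pmap (@pickle_inv X) (iota 0 n).

Lemma enum_prefixS n : enum_prefix n.+1 =
  enum_prefix n ++ (if @pickle_inv X n is Some x then [:: x] else [::]).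
Proof.
rewrite /enum_prefix -addn1 iotaD pmap_cat add0n /=.
by case: pickle_inv.
Qed.

Lemma mem_enum_prefix n x : (x \in enum_prefix n) = (pickle x < n)%N.
Proof.
rewrite mem_pmap; apply/mapP/idP => [[i]|xn].
  rewrite mem_iota add0n /= => i_n xi.
  by have := @pickle_invK X i; rewrite -xi /= => ->.
by exists (pickle x); rewrite ?mem_iota ?pickleK_inv.
Qed.

Lemma enum_prefix_uniq n : uniq (enum_prefix n).
Proof.
elim: n => // n IH; rewrite enum_prefixS.
case E: (@pickle_inv X n) => [x|]; last by rewrite cats0.
rewrite cats1 rcons_uniq IH andbT mem_enum_prefix.
by rewrite -leqNgt; have := @pickle_invK X n; rewrite E /= => ->.
Qed.
End pickle_inv.

(** * The filtration generated by the noise, and independence of the next noise term from it *)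

Section history.
Local Open Scope classical_set_scope.
Context d (T : measurableType d) (R : realType) (P : probability T R).
Context (X : countType) (sigma : X -> R) (eps : X -> {RV P >-> R}).
Hypothesis sigma0 : forall x, 0 < sigma x.
Hypothesis noise : gaussian_noise sigma eps.

(** Cylinder events of the noise terms enumerated before [n]. They form a pi-system generating the
    past, and they are the events on which mutual independence gives information directly. *)
Definition past_event (n : nat) : set (set T) := [set C | exists A : X -> set R,
  (forall x, measurable (A x)) /\
  C = \bigcap_(x in [set` enum_prefix X n]) (eps x @^-1` A x)].

Definition past_measurable (n : nat) (f : T -> R) :=
  measurable_fun [set: g_sigma_algebraType (past_event n)] f.

Lemma past_event_measurable n : past_event n `<=` measurable.
Proof.
move=> C [A [mA ->]].
rewrite bigcap_seq; apply: bigsetI_measurable => x _.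
by rewrite -[X in measurable X]setTI; exact: measurable_funP.
Qed.

Lemma past_event_setI n : setI_closed (past_event n).
Proof.
move=> _ _ [A [mA ->]] [B [mB ->]].
exists (fun x => A x `&` B x); split; first by move=> x; exact: measurableI.
by rewrite -bigcapI.
Qed.

Lemma past_eventT n : past_event n setT.
Proof. by exists (fun=> setT); split => //; rewrite bigcapT. Qed.

Lemma past_eventS n : past_event n `<=` past_event n.+1.
Proof.
move=> _ [A [mA ->]].
exists (fun x => if x \in enum_prefix X n then A x else setT); split.
  by move=> x; case: ifP.
apply/seteqP; split => t /= H x /=.
  by case: ifPn => // xn _; exact: H.
by move=> xn; have := H x; rewrite /= xn; apply; rewrite enum_prefixS mem_cat xn.
Qed.

Lemma past_measurable_measurable n f : past_measurable n f -> measurable_fun setT f.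
Proof.
move=> mf _ Y mY; have := mf measurableT Y mY.
rewrite setTI => H.
apply: (smallest_sub _ (@past_event_measurable n)) H.
exact: sigma_algebra_measurable.
Qed.

Lemma past_measurableS n f : past_measurable n f -> past_measurable n.+1 f.
Proof.
move=> mf _ Y mY; have := mf measurableT Y mY.
apply: smallest_sub; first exact: smallest_sigma_algebra.
by move=> C nC; apply: sub_sigma_algebra; exact: past_eventS.
Qed.

Lemma past_measurable_noise n x : @pickle_inv X n = Some x -> past_measurable n.+1 (eps x).
Proof.
move=> nx _ Y mY; rewrite setTI; apply: sub_sigma_algebra.
exists (fun y => if y == x then Y else setT); split; first by move=> y; case: ifP.
have xn : x \in enum_prefix X n.+1.
  by rewrite enum_prefixS nx mem_cat mem_seq1 eqxx orbT.
apply/seteqP; split => t /= H.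
  by move=> y _; case: eqP => // ->.
by have := H x xn; rewrite eqxx.
Qed.

(** For a fixed noise event E, the measures A |-> P (A & E) and A |-> P E * P A agree on the
    pi-system of cylinders, hence on the sigma-algebra that it generates. *)
Lemma past_independent n x A B : @pickle_inv X n = Some x ->
  <<s past_event n >> A -> measurable B ->
  P (A `&` eps x @^-1` B) = (P A * P (eps x @^-1` B))%E.
Proof.
move=> nx + mB.
have mE : measurable (eps x @^-1` B).
  by rewrite -[X in measurable X]setTI; exact: measurable_funP.
pose r : {nonneg R} := NngNum (fine_ge0 (measure_ge0 P (eps x @^-1` B))).
suff H : <<s past_event n >> A -> mrestr P mE A = mscale r P A.
  move=> /H; rewrite /mrestr /mscale/= => ->.
  by rewrite fineK ?fin_num_measure// muleC.
apply: (@g_sigma_algebra_measure_unique _ _ _ (past_event n) _ (fun=> setT)).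
- exact: past_event_measurable.
- by move=> _; exact: past_eventT.
- by rewrite bigcup_const//; exists 0%N.
- exact: past_event_setI.
- move=> _ [C [mC ->]].
  set E := \bigcap_(_ in _) _.
  change (P (E `&` eps x @^-1` B) = (fine (P (eps x @^-1` B)))%:E * P E)%E.
  rewrite fineK ?fin_num_measure// {}/E.
  have [ind _] := noise.
  have xn : x \notin enum_prefix X n.
    rewrite mem_enum_prefix -leqNgt.
    by have := @pickle_invK X n; rewrite nx /= => ->.
  (* One family of sets describes both the cylinder and the new event; as [x] lies outside the
     prefix, no constraint of [C] is overwritten there. *)
  pose C' y := if y == x then B else C y.
  have mC' y : measurable (C' y) by rewrite /C'; case: ifP.
  have := ind (x :: enum_prefix X n) C' _ mC'; rewrite /= xn enum_prefix_uniq => /(_ isT).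
  rewrite big_cons {2}/C' eqxx.
  rewrite [X in P X](_ : _ = \bigcap_(x0 in [set` enum_prefix X n]) (eps x0 @^-1` C x0) `&` eps x @^-1` B); last first.
    apply/seteqP; split => t /=.
      move=> H; split; last by have := H x; rewrite /C' eqxx /=; apply; rewrite /= inE eqxx.
      move=> y yn; have := H y; rewrite /C' /= inE.
      case: eqP => [yx|_]; first by move: xn; rewrite -yx yn.
      by apply.
    move=> [H1 H2] y; rewrite /= inE /C'; case: eqP => [->//|_ /= yn].
    exact: H1.
  move=> ->; congr (_ * _)%E.
  rewrite ind ?enum_prefix_uniq//.
  rewrite [LHS]big_seq [RHS]big_seq; apply: eq_bigr => y yn; rewrite /C'; case: eqP => // yx.
  by move: xn; rewrite -yx yn.
- by move=> k; rewrite ltey_eq fin_num_measure.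
Qed.

End history.

Section limits.
Local Open Scope classical_set_scope.
Context {R : realType}.

(** This is the derivative at 0 of z |-> sin (y z), read along z = 1 / (n + 1). *)
Lemma cvg_sin_scaled (y : R) : n.+1%:R * sin (y / n.+1%:R) @[n --> \oo] --> y.
Proof.
have H := is_derive_sin_affine y 0 0.
have := @derive_val _ _ _ _ _ _ _ H; rewrite mulr0 addr0 cos0 mulr1 => dv.
have cv : h^-1 *: (((fun z : R => sin (y * z + 0)) \o shift 0) (h *: 1)
    - sin (y * 0 + 0)) @[h --> 0^'] --> y.
  by have := @ex_derive _ _ _ _ _ _ _ H; rewrite -[X in _ --> X]dv.
have hn : (forall n, (n.+1%:R^-1 : R) != 0) /\ (n.+1%:R^-1 : R) @[n --> \oo] --> 0.
  by split => //; exact: cvg_harmonic.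
move/cvgr_dnbhsP : cv => /(_ _ hn); apply: cvg_trans.
apply: near_eq_cvg; apply: nearW => n /=.
by rewrite /GRing.scale/= mulr1 mulr0 !addr0 sin0 subr0 invrK.
Qed.

(** All quantifiers range over integers, so the convergence set of random sequences is a countable
    combination of events; comparing with the single term [u N] matches sums that start at [N]. *)
Lemma cvgn_cauchyP (u : R^nat) :
  cvgn u <-> forall k, exists N, forall n, (N <= n)%N -> `|u n - u N| <= k.+1%:R^-1.
Proof.
split=> [/cvg_cauchy/cauchy_ballP H k|H].
  have /H : 0 < (k.+1%:R^-1 : R) by [].
  move=> [[A B]/= [[N1 _ A1] [N2 _ B2]] AB].
  exists (maxn N1 N2) => n Nn; apply: ltW; rewrite distrC.
  apply: (AB (u (maxn N1 N2), u n)); split => /=.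
    by apply: A1; rewrite /= leq_maxl.
  by apply: B2; rewrite /= (leq_trans _ Nn)// leq_maxr.
apply: cauchy_cvg; apply: cauchy_exP => e e0.
have [k ke] : exists k : nat, k.+1%:R^-1 < e.
  exists (Num.truncn e^-1); rewrite invf_plt ?posrE//; exact: truncnS_gt.
have [N HN] := H k; exists (u N); exists N => // n /= Nn.
by rewrite /ball/= distrC (le_lt_trans (HN n Nn)).
Qed.

Lemma cvgn_sum (I : Type) (s : seq I) (u : I -> R^nat) (l : I -> R) :
  (forall i, u i n @[n --> \oo] --> l i) ->
  \sum_(i <- s) u i n @[n --> \oo] --> \sum_(i <- s) l i.
Proof.
move=> ul; elim: s => [|i s IH].
  by under eq_fun do rewrite big_nil; rewrite big_nil; exact: cvg_cst.
under eq_fun do rewrite big_cons.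
by rewrite big_cons; apply: cvgD => //; exact: ul.
Qed.

End limits.

(** * Expectations of cosines of partial and stopped sums of the noise *)

Section noise_series.
Local Open Scope classical_set_scope.
Context d (T : measurableType d) (R : realType) (P : probability T R).
Context (X : countType) (sigma : X -> R) (eps : X -> {RV P >-> R}).
Hypothesis sigma0 : forall x, 0 < sigma x.
Hypothesis noise : gaussian_noise sigma eps.
Variable b : X -> R.

Definition noise_term (n : nat) (t : T) : R :=
  oapp (fun x => b x * eps x t) 0 (@pickle_inv X n).

Definition noise_var (n : nat) : R :=
  oapp (fun x => b x ^+ 2 * sigma x ^+ 2) 0 (@pickle_inv X n).

Lemma noise_var_ge0 n : 0 <= noise_var n.
Proof. by rewrite /noise_var; case: pickle_inv => //= x; rewrite mulr_ge0 ?sqr_ge0. Qed.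

Lemma past_measurable_noise_term n : past_measurable eps n.+1 (noise_term n).
Proof.
rewrite /noise_term; case E: (@pickle_inv X n) => [x|]/=.
  by apply: measurable_funM => //; exact: past_measurable_noise.
exact: measurable_cst.
Qed.

Lemma Rintegral_past_mul_cos n (H : T -> R) (M r c : R) :
  past_measurable eps n H -> (forall t, `|H t| <= M) ->
  (\int[P]_t (H t * cos (r * noise_term n t + c)) =
   cos c * expR (- (r ^+ 2 * noise_var n / 2)) * \int[P]_t H t)%R.
Proof.
move=> mH HM; have mHT := past_measurable_measurable mH.
have iH : P.-integrable setT (EFin \o H) by exact: bounded_integrable mHT HM.
rewrite /noise_term /noise_var; case E: (@pickle_inv X n) => [x|]/=; last first.
  rewrite !mulr0 mul0r oppr0 expR0 mulr1 add0r RintegralZr// mulrC//.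
(* Clamping gives a function bounded on the whole line, as the product formula requires, that is the
   identity on the values of [H]. *)
pose h (y : R) := Num.max (- M) (Num.min y M).
have mh : measurable_fun setT h.
  by apply: measurable_maxr => //; exact: measurable_minr.
have hM y : `|h y| <= `|M|.
  rewrite ler_norml /h le_max ge_max ge_min lerN2 ler_norm/=.
  by rewrite -{1}normrN ler_norm orbT.
have hH t : h (H t) = H t.
  by have := HM t; rewrite ler_norml => /andP[h1 h2]; rewrite /h min_l// max_r.
pose X' : {mfun T >-> R} := HB.pack H (isMeasurableFun.Build _ _ _ _ _ mHT).
pose f y := cos (r * (b x * y) + c).
have mf : measurable_fun setT f.
  apply: measurableT_comp; first exact: continuous_measurable_fun (@continuous_cos R).
  by apply: measurable_funD => //; do 2 apply: measurable_funM => //.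
have fM y : `|f y| <= 1 by exact: cos_max.
have XY A B : measurable A -> measurable B ->
    P (X' @^-1` A `&` eps x @^-1` B) = (P (X' @^-1` A) * P (eps x @^-1` B))%E.
  move=> mA mB; apply: (past_independent noise E) => //.
  by have := mH measurableT A mA; rewrite setTI.
have := Rintegral_independent_mul XY mh hM mf fM.
rewrite /=; under eq_Rintegral do rewrite hH.
move=> ->; rewrite mulrC; congr (_ * _); last by apply: eq_Rintegral => t _; rewrite hH.
(* [normal_prob] is a measure on [measurableTypeR R], which has the same measurable
   sets as [R] but another display. *)
have mY : measurable_fun setT (eps x : T -> measurableTypeR R).
  have me : measurable_fun setT (eps x) by [].
  by move=> mT B mB; exact: (me measurableT B mB).
pose Y : {mfun T >-> measurableTypeR R} :=
  HB.pack (eps x : T -> measurableTypeR R) (isMeasurableFun.Build _ _ _ _ _ mY).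
have -> : (\int[P]_t f (eps x t) = \int[normal_prob 0 (sigma x)]_y f y)%R.
  rewrite -[LHS](@Rintegral_distribution _ _ _ P _ (measurableTypeR R) Y f 1)//.
  rewrite /Rintegral; congr fine; apply: eq_measure_integral => A mA _.
  by have [_ law] := noise; exact: (law x A mA).
rewrite /f; under eq_Rintegral do rewrite mulrA.
by rewrite integral_cos_normal_prob// exprMn mulrA.
Qed.

(** In cos (U + rX) = cos U cos rX - sin U sin rX the second product has mean 0, because a centred
    Gaussian [X] independent of the past gives sin rX mean 0; the first one only gains the Gaussian
    factor. *)
Lemma Rintegral_past_cosD n (w U : T -> R) (M r : R) :
  past_measurable eps n w -> (forall t, `|w t| <= M) -> past_measurable eps n U ->
  (\int[P]_t (w t * cos (U t + r * noise_term n t)) =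
   expR (- (r ^+ 2 * noise_var n / 2)) * \int[P]_t (w t * cos (U t)))%R.
Proof.
move=> mw wM mU.
have mc : past_measurable eps n (fun t => w t * cos (U t)).
  apply: measurable_funM => //; apply: measurableT_comp mU.
  exact: continuous_measurable_fun (@continuous_cos R).
have ms : past_measurable eps n (fun t => w t * sin (U t)).
  apply: measurable_funM => //; apply: measurableT_comp mU.
  exact: continuous_measurable_fun (@continuous_sin R).
have bc t : `|w t * cos (U t)| <= M.
  by rewrite normrM (le_trans _ (wM t))// ler_piMr// cos_max.
have bs t : `|w t * sin (U t)| <= M.
  by rewrite normrM (le_trans _ (wM t))// ler_piMr// sin_max.
have mt : measurable_fun setT (noise_term n).
  exact: (past_measurable_measurable (@past_measurable_noise_term n)).
have mcos c : measurable_fun setT (fun t => cos (r * noise_term n t + c)).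
  apply: measurableT_comp; first exact: continuous_measurable_fun (@continuous_cos R).
  by apply: measurable_funD => //; exact: measurable_funM.
have E1 := Rintegral_past_mul_cos r 0 mc bc.
(* With phase [- (pi / 2)] the cosine is sin rX, and the factor [cos c] of the formula vanishes. *)
have E2 := Rintegral_past_mul_cos r (- (pi / 2)) ms bs.
rewrite cosN cos_pihalf !mul0r in E2.
rewrite cos0 mul1r in E1; rewrite -E1 -[LHS]addr0 -{1}E2 -RintegralD//=.
- apply: eq_Rintegral => t _.
  rewrite addr0 cosD.
  by rewrite cosBpihalf; ring.
- apply: (@bounded_integrable _ _ _ P _ M).
    apply: measurable_funM; first exact: past_measurable_measurable mw.
    apply: measurableT_comp; first exact: continuous_measurable_fun (@continuous_cos R).
    apply: measurable_funD; first exact: past_measurable_measurable mU.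
    exact: measurable_funM.
  by move=> t; rewrite normrM (le_trans _ (wM t))// ler_piMr// cos_max.
- apply: (@bounded_integrable _ _ _ P _ M).
    apply: measurable_funM; first exact: past_measurable_measurable ms.
    exact: mcos.
  by move=> t; rewrite normrM (le_trans _ (bs t))// ler_piMr// cos_max.
Qed.

Lemma Rintegral_cos_psum (c r : R) n :
  (\int[P]_t cos (c + r * psum (fun x => b x * eps x t) n) =
   cos c * expR (- (r ^+ 2 * psum (fun x => b x ^+ 2 * sigma x ^+ 2) n / 2)))%R.
Proof.
elim: n => [|n IH].
  rewrite /psum big_nil mulr0 mul0r oppr0 expR0 mulr1.
  under eq_Rintegral do rewrite big_nil mulr0 addr0.
  by rewrite Rintegral_probability_cst.
have mU : past_measurable eps n (fun t => c + r * psum (fun x => b x * eps x t) n).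
  apply: measurable_funD => //; apply: measurable_funM => //.
  rewrite /psum; elim: n {IH} => [|n IH].
    by under eq_fun do rewrite big_nil; exact: measurable_cst.
  under eq_fun do rewrite big_nat_recr//=.
  apply: measurable_funD; first exact: past_measurableS.
  exact: past_measurable_noise_term.
have := @Rintegral_past_cosD n (fun=> 1) _ 1 r (@measurable_cst _ _ _ _ _ _)
  (fun=> _) mU.
rewrite normr1 => /(_ (fun=> lexx _)).
under eq_Rintegral do rewrite mul1r.
under [X in _ = _ * X -> _]eq_Rintegral do rewrite mul1r.
rewrite IH => H.
transitivity (\int[P]_t cos (c + r * psum (fun x => b x * eps x t) n + r * noise_term n t))%R.
  apply: eq_Rintegral => t _.
  by rewrite -addrA -mulrDr /psum big_nat_recr.
rewrite H [LHS]mulrC -[LHS]mulrA -expRD /psum big_nat_recr//= -/(noise_var n).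
by congr (_ * expR _); field.
Qed.

(* Stopping keeps Kolmogorov's argument within expectations of cosines; the second
   moment is recovered by Fatou's lemma from [2 n ^+ 2 (1 - cos (M / n)) --> M ^+ 2]. *)
Fixpoint stopped_sum (N : nat) (lam : R) (n : nat) (t : T) : R :=
  if n is m.+1 then
    stopped_sum N lam m t +
    (if (N <= m)%N && (`|stopped_sum N lam m t| <= lam) then noise_term m t else 0)
  else 0.

Lemma past_measurable_stopped_sum N lam n :
  past_measurable eps n (stopped_sum N lam n).
Proof.
elim: n => [|n IH]/=; first exact: measurable_cst.
have IH' := past_measurableS IH.
apply: measurable_funD => //; case: (N <= n)%N => /=; last exact: measurable_cst.
apply: measurable_fun_ifT => //; last exact: past_measurable_noise_term.
by apply: measurable_fun_ler => //; exact: measurableT_comp.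
Qed.

(** Whether the sum is still running is decided by the past. Where it runs, the next term multiplies
    the mean of the cosine by e = exp (- r^2 v / 2) >= 1 - r^2 v / 2; elsewhere nothing changes.
    Each step thus costs at most r^2 v / 2. *)
Lemma stopped_sum_cos_ge N lam n (r : R) :
  1 - r ^+ 2 / 2 * (\sum_(0 <= i < n | (N <= i)%N) noise_var i) <=
  (\int[P]_t cos (r * stopped_sum N lam n t))%R.
Proof.
have mcos m : past_measurable eps m (fun t => cos (r * stopped_sum N lam m t)).
  apply: measurableT_comp; first exact: continuous_measurable_fun (@continuous_cos R).
  by apply: measurable_funM => //; exact: past_measurable_stopped_sum.
elim: n => [|n IH].
  rewrite big_nil mulr0 subr0 /=.
  under eq_Rintegral do rewrite mulr0 cos0.
  by rewrite Rintegral_probability_cst.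
rewrite [X in _ * X]big_mkcond/= big_nat_recr//= -big_mkcond/=.
pose A t := (N <= n)%N && (`|stopped_sum N lam n t| <= lam).
have mA : past_measurable eps n (fun t => (A t)%:R).
  have -> : (fun t => (A t)%:R) = (fun t => if A t then 1 else 0 : R).
    by apply/funext => t; case: (A t).
  rewrite /A; case: (N <= n)%N => /=; last exact: measurable_cst.
  apply: measurable_fun_ifT => //; apply: measurable_fun_ler => //.
  apply: measurableT_comp => //.
  exact: past_measurable_stopped_sum.
have bA t : `|(A t)%:R : R| <= 1 by case: (A t); rewrite ?normr1 ?normr0.
have mM : past_measurable eps n (fun t => r * stopped_sum N lam n t).
  by apply: measurable_funM => //; exact: past_measurable_stopped_sum.
have iAcos : P.-integrable setT (EFin \o (fun t => (A t)%:R * cos (r * stopped_sum N lam n t))).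
  apply: (@bounded_integrable _ _ _ P _ 1).
    apply: (past_measurable_measurable (eps := eps) (n := n)).
    by apply: measurable_funM => //; exact: mcos.
  by move=> t; rewrite normrM mulr_ile1// cos_max.
have icos : P.-integrable setT (EFin \o (fun t => cos (r * stopped_sum N lam n t))).
  apply: (@bounded_integrable _ _ _ P _ 1); last by move=> t; exact: cos_max.
  exact: (past_measurable_measurable (mcos n)).
set M := stopped_sum N lam n in mA iAcos icos mM IH *.
(* Split along the indicator [A] of the event that term [n] is added. *)
have E : (\int[P]_t cos (r * stopped_sum N lam n.+1 t) =
  \int[P]_t ((A t)%:R * cos (r * M t + r * noise_term n t)) +
  (\int[P]_t cos (r * M t) - \int[P]_t ((A t)%:R * cos (r * M t))))%R.
  rewrite -RintegralB// -RintegralD//.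
  - apply: eq_Rintegral => t _ /=; rewrite -/(A t) -/M.
    by case: (A t); rewrite ?mul1r ?mul0r ?subrr ?addr0 ?add0r ?subr0// mulrDr.
  - apply: (@bounded_integrable _ _ _ P _ 1).
      apply: measurable_funM; first exact: past_measurable_measurable mA.
      apply: measurableT_comp; first exact: continuous_measurable_fun (@continuous_cos R).
      apply: measurable_funD; first exact: past_measurable_measurable mM.
      apply: measurable_funM => //.
      exact: past_measurable_measurable (@past_measurable_noise_term n).
    by move=> t; rewrite normrM mulr_ile1// cos_max.
  - by have := integrableB measurableT icos iAcos.
rewrite E (Rintegral_past_cosD r mA bA mM).
set e := expR _; set I := (\int[P]_x ((A x)%:R * _))%R.
have I1 : I <= 1.
  rewrite -[leRHS](Rintegral_probability_cst P); apply: le_Rintegral => //.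
    by apply: (@bounded_integrable _ _ _ P (cst 1) 1) => // t; rewrite normr1.
  by move=> t _; rewrite (le_trans (ler_norm _))// normrM mulr_ile1// cos_max.
have e1 : 1 - e <= r ^+ 2 / 2 * noise_var n.
  have := expR_ge1Dx (- (r ^+ 2 * noise_var n / 2)); rewrite -/e; lra.
have e0 : 0 <= 1 - e.
  by rewrite subr_ge0 /e -expR0 ler_expR oppr_le0 divr_ge0// mulr_ge0 ?sqr_ge0 ?noise_var_ge0.
have vN : r ^+ 2 / 2 * (if (N <= n)%N then noise_var n else 0) >= (1 - e) * I.
  case: ifPn => Nn.
    by apply: le_trans e1; exact: (ler_piMr e0 I1).
  rewrite mulr0 /I.
  have -> : (\int[P]_t ((A t)%:R * cos (r * M t)) = \int[P]_t 0)%R.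
    by apply: eq_Rintegral => t _; rewrite /A (negbTE Nn) mul0r.
  by rewrite Rintegral_probability_cst mulr0.
by rewrite mulrDr; lra.
Qed.

End noise_series.

(** * Maximal inequality and almost sure convergence of the noise series *)

Section noise_series_cvg.
Local Open Scope classical_set_scope.
Context d (T : measurableType d) (R : realType) (P : probability T R).
Context (X : countType) (sigma : X -> R) (eps : X -> {RV P >-> R}).
Hypothesis sigma0 : forall x, 0 < sigma x.
Hypothesis noise : gaussian_noise sigma eps.
Variable b : X -> R.

(** By the half-angle formula the expression is the square of 2 n sin (y / (2 n)). *)
Lemma cos_scaled_cvg (y : R) :
  2 * n.+1%:R ^+ 2 * (1 - cos (n.+1%:R^-1 * y)) @[n --> \oo] --> y ^+ 2.
Proof.
have E n : 2 * n.+1%:R ^+ 2 * (1 - cos (n.+1%:R^-1 * y)) =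
   (2 * (n.+1%:R * sin ((y / 2) / n.+1%:R))) ^+ 2.
  set z := (y / 2) / n.+1%:R.
  have -> : n.+1%:R^-1 * y = z + z by rewrite /z; field.
  rewrite cosD; have := cos2Dsin2 z => H.
  have -> : cos z * cos z = 1 - sin z ^+ 2 by rewrite -H; ring.
  ring.
under eq_fun do rewrite E.
have -> : y ^+ 2 = (2 * (y / 2)) ^+ 2 by field.
under eq_fun do rewrite expr2.
rewrite expr2; apply: cvgM; apply: cvgMr; exact: cvg_sin_scaled.
Qed.

Local Notation M := (stopped_sum (P := P) eps b).
Local Notation v := (noise_var (X := X) sigma b).

Lemma measurable_stopped_sum (N : nat) (lam : R) (n : nat) : measurable_fun setT (M N lam n).
Proof. exact: past_measurable_measurable (@past_measurable_stopped_sum _ _ _ _ _ _ _ N lam n). Qed.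

Lemma integral_stopped_sum_sqr_le (N : nat) (lam : R) (n : nat) :
  (\int[P]_t ((M N lam n t) ^+ 2)%:E <= (\sum_(0 <= i < n | (N <= i)%N) v i)%:E)%E.
Proof.
set V := \sum_(_ <= _ < _ | _) _.
pose f (j : nat) t := 2 * j.+1%:R ^+ 2 * (1 - cos (j.+1%:R^-1 * M N lam n t)).
have mM := measurable_stopped_sum N lam n.
have mc j : measurable_fun setT (fun t => cos (j.+1%:R^-1 * M N lam n t)).
  apply: measurableT_comp; first exact: continuous_measurable_fun (@continuous_cos R).
  exact: measurable_funM.
have mf j : measurable_fun setT (f j).
  by apply: measurable_funM => //; apply: measurable_funB.
have f0 j t : 0 <= f j t.
  by rewrite mulr_ge0// subr_ge0 (le_trans (ler_norm _))// cos_max.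
have fV j : (\int[P]_t (f j t)%:E <= V%:E)%E.
  have ic : P.-integrable setT (EFin \o (fun t => cos (j.+1%:R^-1 * M N lam n t))).
    by apply: (@bounded_integrable _ _ _ P _ 1) => // t; exact: cos_max.
  have i1 : P.-integrable setT (EFin \o (fun t : T => 1 : R)).
    by apply: (@bounded_integrable _ _ _ P _ 1) => // t; rewrite normr1.
  have -> : (\int[P]_t (f j t)%:E)%E =
      (2 * j.+1%:R ^+ 2 * (1 - \int[P]_t cos (j.+1%:R^-1 * M N lam n t)))%R%:E.
    rewrite -[X in (X - _)](Rintegral_probability_cst P) -RintegralB// -RintegralZl//; last first.
      by have := integrableB measurableT i1 ic.
    rewrite fineK//; apply: integrable_fin_num => //.
    by have := integrableZl measurableT (2 * j.+1%:R ^+ 2) (integrableB measurableT i1 ic).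
  rewrite lee_fin; have := stopped_sum_cos_ge sigma0 noise b N lam n j.+1%:R^-1.
  rewrite -/V; set I := (\int[P]_t _)%R => HI.
  (* With r = 1 / (j + 1) the prefactor cancels r^2 / 2 exactly, so the bound [V] does not depend on
     [j]. *)
  have -> : V = 2 * j.+1%:R ^+ 2 * (j.+1%:R^-1 ^+ 2 / 2 * V) by field.
  rewrite ler_pM2l; first by rewrite lerBlDr addrC -lerBlDr.
  by rewrite mulr_gt0// exprn_gt0.
have := fatou P measurableT (fun j => (measurable_EFinP _ _).2 (mf j)) (fun j t _ => f0 j t).
rewrite (_ : (\int[P]_t _)%E = (\int[P]_t ((M N lam n t) ^+ 2)%:E)%E); last first.
  apply: eq_integral => t _.
  have cv : ((f j t)%:E @[j --> \oo] --> ((M N lam n t) ^+ 2)%:E)%E.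
    by apply: cvg_EFin; [exact: nearW | exact: cos_scaled_cvg].
  by rewrite is_cvg_limn_einfE; [exact/cvg_lim | exact: (cvgP _ cv)].
move=> /le_trans; apply.
rewrite limn_einf_lim; apply: lime_le; first exact: is_cvg_einfs.
apply: nearW => m; apply: le_trans (fV m).
by apply: ereal_inf_lbound; exists m => //=.
Qed.

(** Chebyshev's inequality at the single time [n]. It is a maximal inequality because the sum is
    frozen once it exceeds [lam]: exceeding at time [n] means that some increment from [N] up to [n]
    exceeded. *)
Lemma stopped_sum_maximal (N : nat) (lam : R) (n : nat) : 0 < lam ->
  (P [set t | (lam < `|M N lam n t|)%R] <=
   (lam ^- 2 * \sum_(0 <= i < n | (N <= i)%N) v i)%R%:E)%E.
Proof.
move=> lam0; have mM := measurable_stopped_sum N lam n.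
have mA : measurable [set t | lam < `|M N lam n t|].
  rewrite -[X in measurable X]setTI.
  apply: (measurable_fun_ltr (f := cst lam) (g := fun t => `|M N lam n t|)) => //.
  exact: measurableT_comp.
set A := [set t | _] in mA *.
have H : ((lam ^+ 2)%:E * P A <= (\sum_(0 <= i < n | (N <= i)%N) v i)%:E)%E.
  apply: le_trans (integral_stopped_sum_sqr_le N lam n).
  rewrite -(integral_cst P mA).
  have msq : measurable_fun setT (fun t => ((M N lam n t) ^+ 2)%:E).
    by apply/measurable_EFinP; exact: measurable_funX.
  apply: (@le_trans _ _ (\int[P]_(t in A) ((M N lam n t) ^+ 2)%:E)%E).
    apply: ge0_le_integral => //=.
    - by move=> t _; rewrite lee_fin sqr_ge0.
    - exact: measurable_funTS.
    - move=> t /= At; rewrite lee_fin -(real_normK (num_real (M N lam n t))).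
      by rewrite lerXn2r ?nnegrE ?(ltW lam0)// ltW.
  by apply: ge0_subset_integral => //= t _; rewrite lee_fin sqr_ge0.
by rewrite EFinM lee_pdivlMl ?exprn_gt0.
Qed.

Lemma stopped_sumP (N : nat) (lam : R) (n : nat) (t : T) : (N <= n)%N ->
  lam < `|M N lam n t| \/
  M N lam n t = psum (fun x => b x * eps x t) n - psum (fun x => b x * eps x t) N.
Proof.
have M0 m : (m <= N)%N -> M N lam m t = 0.
  elim: m => //= m IH mN; rewrite IH ?(ltnW mN)// add0r.
  by rewrite leqNgt mN.
elim: n => [|n IH] Nn.
  by right; move: Nn; rewrite leqn0 => /eqP ->; rewrite subrr.
move: Nn; rewrite leq_eqVlt => /predU1P[<-|]; first by right; rewrite M0// subrr.
rewrite ltnS => Nn /=; rewrite Nn/=.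
have [Mle|Mgt] := leP `|M N lam n t| lam; last by left; rewrite addr0.
have [/lt_geF|->] := IH Nn; first by rewrite Mle.
by right; rewrite /psum big_nat_recr//= /noise_term addrAC.
Qed.

Lemma stopped_sum_nondecreasing (N : nat) (lam : R) :
  {homo (fun n => [set t | lam < `|M N lam n t|]) : n m / (n <= m)%N >-> (n <= m)%O}.
Proof.
apply/nondecreasing_seqP => n; apply/subsetPset => t /= H.
by rewrite [_ <= lam]leNgt H andbF addr0.
Qed.

Lemma noise_series_ae_cvg : cvgn (psum (fun x => b x ^+ 2 * sigma x ^+ 2)) ->
  {ae P, forall t, cvgn (psum (fun x => b x * eps x t))}.
Proof.
set V := limn _ => cV.
have vV m : psum (fun x => b x ^+ 2 * sigma x ^+ 2) m <= V.
  apply: nondecreasing_cvgn_le cV m; apply/nondecreasing_seqP => m.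
  by rewrite /psum big_nat_recr//= lerDl; exact: noise_var_ge0.
pose A k N n := [set t | k.+1%:R^-1 < `|M N k.+1%:R^-1 n t|].
have mA k N n : measurable (A k N n).
  rewrite -[X in measurable X]setTI.
  apply: (measurable_fun_ltr (f := cst _) (g := fun t => `|M N _ n t|)) => //.
  apply: measurableT_comp => //; exact: measurable_stopped_sum.
(* Failure of the Cauchy criterion at precision 1 / (k + 1): after every [N], some later partial sum
   escapes. *)
pose B k := \bigcap_N \bigcup_n A k N n.
have mB k : measurable (B k).
  by apply: bigcapT_measurable => N; exact: bigcupT_measurable.
have B0 k : P (B k) = 0%E.
  apply/eqP; rewrite eq_le measure_ge0 andbT.
  have PN N : (P (B k) <= (k.+1%:R ^+ 2 * (V - psum (fun x => b x ^+ 2 * sigma x ^+ 2) N))%:E)%E.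
    apply: (@le_trans _ _ (P (\bigcup_n A k N n))).
      apply: le_measure; rewrite ?inE//; first exact: bigcupT_measurable.
      by move=> t; apply.
    (* The events increase with [n], so continuity from below extends the bound by the tail variance
       after [N] from each [n] to their union; this tail tends to 0. *)
    have cv := nondecreasing_cvg_mu (mA k N) (bigcupT_measurable _ (mA k N))
      (@stopped_sum_nondecreasing N k.+1%:R^-1) (mu := P).
    rewrite -(cvg_lim _ cv)//; apply: lime_le; first exact: (cvgP _ cv).
    apply: nearW => n; apply: le_trans (stopped_sum_maximal _ _ _) _ => //.
    rewrite lee_fin exprVn invrK ler_wpM2l ?sqr_ge0//.
    rewrite -(big_nat_widenl N 0 n predT)//.
    have [nN|Nn] := leqP n N; first by rewrite big_geq// subr_ge0.
    rewrite lerBrDl (le_trans _ (vV n))// /psum [leRHS](@big_cat_nat _ _ _ N)//=.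
    exact: ltnW.
  have cvN : (k.+1%:R ^+ 2 * (V - psum (fun x => b x ^+ 2 * sigma x ^+ 2) N))%:E
      @[N --> \oo] --> 0%E.
    apply: cvg_EFin; first exact: nearW.
    rewrite -[X in _ --> X](mulr0 (k.+1%:R ^+ 2 : R)) -(subrr V); apply: cvgMr.
    by apply: cvgB => //; exact: cvg_cst.
  rewrite -(cvg_lim _ cvN)//; apply: lime_ge; first exact: (cvgP _ cvN).
  exact: nearW.
have nB : P.-negligible (\bigcup_k B k).
  by apply: negligible_bigcup => k; exists (B k); split => //; exact: B0.
apply: negligibleS nB => t /= Nc; apply: contrapT => nBt; apply: Nc.
apply/cvgn_cauchyP => k.
have : ~ B k t by move=> Bt; apply: nBt; exists k.
move=> /existsNP[N /not_implyP[_ NB]]; exists N => n Nn.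
rewrite leNgt; apply/negP => lt; apply: NB; exists n => //.
by have [//|E] := stopped_sumP k.+1%:R^-1 t Nn; rewrite /A/= E.
Qed.

End noise_series_cvg.

(** * The mean of the softmax function is determined by those of cosines *)

Section softmax_law.
Local Open Scope classical_set_scope.
Context {R : realType} (K : nat).
Context d (T : measurableType d) (P : probability T R) (Z : T -> 'I_K -> R).
Context d' (T' : measurableType d') (P' : probability T' R) (Z' : T' -> 'I_K -> R).

Definition trig (theta : 'I_K -> R) (c : R) (y : 'I_K -> R) : R :=
  cos (\sum_l theta l * y l + c).

(** Boundedness and measurability are bundled with the equality so that sums and limits are
    integrable on both spaces at once. *)
Definition same_mean (f : ('I_K -> R) -> R) : Prop :=
  [/\ exists M, forall y, `|f y| <= M,
      measurable_fun setT (f \o Z), measurable_fun setT (f \o Z') &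
      (\int[P]_t f (Z t) = \int[P']_t f (Z' t))%R].

Lemma same_meanD f g : same_mean f -> same_mean g ->
  same_mean (fun y => f y + g y).
Proof.
move=> [[M fM] mf mf' ff'] [[N gN] mg mg' gg']; split.
- by exists (M + N) => y; rewrite (le_trans (ler_normD _ _))// lerD.
- exact: measurable_funD mf mg.
- exact: measurable_funD mf' mg'.
- rewrite !RintegralD//.
  + by rewrite ff' gg'.
  + exact: bounded_integrable mf' (fun t => fM (Z' t)).
  + exact: bounded_integrable mg' (fun t => gN (Z' t)).
  + exact: bounded_integrable mf (fun t => fM (Z t)).
  + exact: bounded_integrable mg (fun t => gN (Z t)).
Qed.

Lemma same_meanZ a f : same_mean f -> same_mean (fun y => a * f y).
Proof.
move=> [[M fM] mf mf' ff']; split.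
- by exists (`|a| * M) => y; rewrite normrM ler_wpM2l.
- exact: measurable_funM (measurable_cst _) mf.
- exact: measurable_funM (measurable_cst _) mf'.
- rewrite !RintegralZl//; first by rewrite ff'.
  + exact: bounded_integrable mf' (fun t => fM (Z' t)).
  + exact: bounded_integrable mf (fun t => fM (Z t)).
Qed.

Lemma same_mean_lim (f_ : nat -> ('I_K -> R) -> R) (f : ('I_K -> R) -> R) (M : R) :
  (forall n, same_mean (f_ n)) -> (forall n y, `|f_ n y| <= M) ->
  (forall y, f_ ^~ y @ \oo --> f y) -> same_mean f.
Proof.
move=> sf fM cf.
have mf : measurable_fun setT (f \o Z).
  apply: (@measurable_fun_cvg _ _ _ setT (fun n => f_ n \o Z)).
    by move=> n; have [] := sf n.
  by move=> t _; exact: cf.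
have mf' : measurable_fun setT (f \o Z').
  apply: (@measurable_fun_cvg _ _ _ setT (fun n => f_ n \o Z')).
    by move=> n; have [] := sf n.
  by move=> t _; exact: cf.
split => //.
  exists M => y; have cfn : `|f_ n y| @[n --> \oo] --> `|f y| by apply: cvg_norm; exact: cf.
  rewrite -(cvg_lim _ cfn)//; apply: limr_le; first exact: (cvgP _ cfn).
  exact: nearW.
have c1 : (\int[P]_t f_ n (Z t))%R @[n --> \oo] --> (\int[P]_t f (Z t))%R.
  apply: (@Rintegral_bounded_cvg _ _ _ P (fun n => f_ n \o Z) (f \o Z) M) => //.
  - by move=> n; have [] := sf n.
  - by move=> n t; exact: fM.
  - by apply: aeW => t; exact: cf.
have c2 : (\int[P']_t f_ n (Z' t))%R @[n --> \oo] --> (\int[P']_t f (Z' t))%R.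
  apply: (@Rintegral_bounded_cvg _ _ _ P' (fun n => f_ n \o Z') (f \o Z') M) => //.
  - by move=> n; have [] := sf n.
  - by move=> n t; exact: fM.
  - by apply: aeW => t; exact: cf.
have E : (fun n => \int[P]_t f_ n (Z t))%R = (fun n => \int[P']_t f_ n (Z' t))%R.
  by apply/funext => n; have [] := sf n.
by rewrite E in c1; exact: (cvg_unique _ c1 c2).
Qed.

Hypothesis mZ : forall l, measurable_fun setT (fun t => Z t l).
Hypothesis mZ' : forall l, measurable_fun setT (fun t => Z' t l).
Hypothesis trigZ : forall theta c,
  (\int[P]_t trig theta c (Z t) = \int[P']_t trig theta c (Z' t))%R.

Lemma same_mean_trig theta c : same_mean (trig theta c).
Proof.
split => //.
- by exists 1 => y; exact: cos_max.
- apply: measurableT_comp; first exact: continuous_measurable_fun (@continuous_cos R).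
  apply: measurable_funD => //; apply: measurable_sum => l.
  exact: measurable_funM.
- apply: measurableT_comp; first exact: continuous_measurable_fun (@continuous_cos R).
  apply: measurable_funD => //; apply: measurable_sum => l.
  exact: measurable_funM.
Qed.

(** The cosine factor is a test function: multiplying [f] by another cosine only changes the test,
    by the product-to-sum formula. *)
Definition trig_same_mean f := forall theta c, same_mean (fun y => f y * trig theta c y).

Lemma trig_mul theta c theta' c' y : trig theta c y * trig theta' c' y =
  2^-1 * (trig (fun l => theta l + theta' l) (c + c') y) +
  2^-1 * (trig (fun l => theta l - theta' l) (c - c') y).
Proof.
rewrite /trig.
under [X in _ = _ * cos (X + _) + _]eq_bigr do rewrite mulrDl.
under [X in _ = _ + _ * cos (X + _)]eq_bigr do rewrite mulrBl.
rewrite big_split sumrB/=.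
set a := \sum_l theta l * y l; set b := \sum_l theta' l * y l.
have -> : a + b + (c + c') = (a + c) + (b + c') by ring.
have -> : a - b + (c - c') = (a + c) - (b + c') by ring.
by move: (a + c) (b + c') => u v; rewrite cosD cosB; field.
Qed.

(* Unlike [same_mean], [multiplier] is closed under products. *)
Definition multiplier f := forall g, trig_same_mean g -> trig_same_mean (fun y => f y * g y).

Lemma multiplierD f g : multiplier f -> multiplier g -> multiplier (fun y => f y + g y).
Proof.
move=> Hf Hg h Hh theta c.
under [X in same_mean X]eq_fun do rewrite !mulrDl.
by apply: same_meanD; [exact: Hf|exact: Hg].
Qed.

Lemma multiplierM f g : multiplier f -> multiplier g -> multiplier (fun y => f y * g y).
Proof.
move=> Hf Hg h Hh theta c.
under [X in same_mean X]eq_fun do rewrite -(mulrA (f _)).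
exact: (Hf _ (Hg _ Hh)).
Qed.

Lemma multiplier_cst a : multiplier (fun=> a).
Proof.
move=> h Hh theta c; under [X in same_mean X]eq_fun do rewrite -mulrA.
exact: same_meanZ.
Qed.

Lemma trig_same_mean_bounded f : trig_same_mean f -> exists M, forall y, `|f y| <= M.
Proof.
move=> /(_ (fun=> 0) 0)[[M fM] _ _ _]; exists M => y.
have := fM y; rewrite /trig big1 ?addr0 ?cos0 ?mulr1// => l _; exact: mul0r.
Qed.

Lemma multiplier_lim (f_ : nat -> ('I_K -> R) -> R) (f : ('I_K -> R) -> R) (M : R) :
  (forall n, multiplier (f_ n)) -> (forall n y, `|f_ n y| <= M) ->
  (forall y, f_ ^~ y @ \oo --> f y) -> multiplier f.
Proof.
move=> Hf fM cf g Hg theta c.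
have [N gN] := trig_same_mean_bounded Hg.
apply: (@same_mean_lim (fun n y => f_ n y * g y * trig theta c y) _ (M * N)).
- by move=> n; exact: Hf.
- move=> n y; rewrite normrM -[leRHS]mulr1 ler_pM ?cos_max//.
  by rewrite normrM ler_pM.
- by move=> y; apply: cvgMl; apply: cvgMl; exact: cf.
Qed.

Lemma multiplier_trig theta c : multiplier (trig theta c).
Proof.
move=> g Hg theta' c'.
have -> : (fun y => trig theta c y * g y * trig theta' c' y) = (fun y =>
   2^-1 * (g y * trig (fun l => theta l + theta' l) (c + c') y) +
   2^-1 * (g y * trig (fun l => theta l - theta' l) (c - c') y)).
  by apply/funext => y; rewrite mulrAC trig_mul; ring.
by apply: same_meanD; apply: same_meanZ; exact: Hg.
Qed.

(** Apply the multiplier to the constant 1, admissible by [trigZ], and test at frequency and phase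
    0, where [trig] equals 1. *)
Lemma multiplier_same_mean f : multiplier f -> same_mean f.
Proof.
move=> Hf.
have H1 : trig_same_mean (fun=> 1).
  by move=> theta c; under [X in same_mean X]eq_fun do rewrite mul1r; exact: same_mean_trig.
have := Hf _ H1 (fun=> 0) 0.
congr same_mean; apply/funext => y.
by rewrite mulr1 /trig big1 ?addr0 ?cos0 ?mulr1// => l _; exact: mul0r.
Qed.

Lemma multiplier_bounded f : multiplier f -> exists M, forall y, `|f y| <= M.
Proof. by move=> /multiplier_same_mean[]. Qed.

Lemma multiplierX f n : multiplier f -> multiplier (fun y => f y ^+ n).
Proof.
move=> Hf; elim: n => [|n IH].
  exact: multiplier_cst.
by under eq_fun do rewrite exprS; exact: multiplierM.
Qed.

Lemma multiplier_sum (I : Type) (s : seq I) (f : I -> ('I_K -> R) -> R) :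
  (forall i, multiplier (f i)) -> multiplier (fun y => \sum_(i <- s) f i y).
Proof.
move=> Hf; elim: s => [|i s IH].
  by under eq_fun do rewrite big_nil; exact: multiplier_cst.
by under eq_fun do rewrite big_cons; exact: multiplierD.
Qed.

(** The partial sums of the exponential series are multipliers, uniformly bounded by exp M when |f|
    <= M. *)
Lemma multiplier_expR f : multiplier f -> multiplier (fun y => expR (f y)).
Proof.
move=> Hf; have [M fM] := multiplier_bounded Hf.
apply: (@multiplier_lim (fun n y => series (exp_coeff (f y)) n) _ (expR M)).
- move=> n; apply: multiplier_sum => i; rewrite /exp_coeff/=.
  by apply: multiplierM; [exact: multiplierX|exact: multiplier_cst].
- move=> n y; rewrite /series/=.
  have M0 : 0 <= M := le_trans (normr_ge0 _) (fM y).
  apply: (@le_trans _ _ (series (exp_coeff M) n)).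
    rewrite (le_trans (ler_norm_sum _ _ _))// ler_sum// => i _.
    rewrite /exp_coeff/= normrM normrX [X in _ * X <= _]ger0_norm ?invr_ge0//.
    by rewrite ler_wpM2r ?invr_ge0// lerXn2r// nnegrE.
  apply: nondecreasing_cvgn_le; last exact: is_cvg_series_exp_coeff.
  apply/nondecreasing_seqP => m; rewrite /series/= big_nat_recr//= lerDl.
  by rewrite /exp_coeff/= divr_ge0// exprn_ge0.
- by move=> y; exact: is_cvg_series_exp_coeff.
Qed.

(** With q = 1 - g / M in [0, 1), the geometric sums give f / M * sum_(i < n) q^i = f / g * (1 -
    q^n). The bound |f| <= g keeps these in [-1, 1] even where [g] is close to 0, so the limit is a
    bounded one. *)
Lemma multiplier_div (f g : ('I_K -> R) -> R) : multiplier f -> multiplier g ->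
  (forall y, `|f y| <= g y) -> (forall y, 0 < g y) -> multiplier (fun y => f y / g y).
Proof.
move=> Hf Hg fg g0; have [M gM] := multiplier_bounded Hg.
pose q y := 1 - g y / M.
have Hq : multiplier q.
  rewrite /q; apply: multiplierD; first exact: multiplier_cst.
  have -> : (fun y => - (g y / M)) = (fun y => g y * (- M^-1)).
    by apply/funext => y; rewrite mulrN.
  by apply: multiplierM => //; exact: multiplier_cst.
have M0 : 0 < M by rewrite (lt_le_trans (g0 (fun=> 0)))// (le_trans (ler_norm _) (gM _)).
have q01 y : 0 <= q y < 1.
  rewrite /q subr_ge0 ler_pdivrMr ?M0// mul1r (le_trans (ler_norm _) (gM y))/=.
  by rewrite ltrBlDr ltrDl divr_gt0// M0.
have E n y : f y / M * \sum_(i < n) q y ^+ i = f y / g y * (1 - q y ^+ n).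
  have := subrX1 (q y) n.
  rewrite {2}/q -addrA addrCA subrr addr0 mulNr => /(congr1 -%R); rewrite opprB opprK => ->.
  by field; rewrite !gt_eqF// M0.
apply: (@multiplier_lim (fun n y => f y / M * \sum_(i < n) q y ^+ i) _ 1).
- move=> n; apply: multiplierM.
    by apply: multiplierM => //; exact: multiplier_cst.
  by apply: multiplier_sum => i; exact: multiplierX.
- move=> n y; rewrite E normrM mulr_ile1//.
    by rewrite normf_div (gtr0_norm (g0 y)) ler_pdivrMr// mul1r.
  have /andP[q0 q1] := q01 y.
  by rewrite ger0_norm ?subr_ge0 ?gerBl ?exprn_ge0// exprn_ile1// ltW.
- move=> y; under eq_fun do rewrite E.
  have /andP[q0 q1] := q01 y.
  have c0 : q y ^+ n @[n --> \oo] --> 0 by apply: cvg_expr; rewrite ger0_norm.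
  have c1 : 1 - q y ^+ n @[n --> \oo] --> (1 - 0 : R) by apply: cvgB => //; exact: cvg_cst.
  have c2 : f y / g y * (1 - q y ^+ n) @[n --> \oo] --> f y / g y * (1 - 0).
    by apply: cvgMr; exact: c1.
  by rewrite subr0 mulr1 in c2.
Qed.

Lemma same_mean_softmax k : same_mean (fun y => normalized_exp y k).
Proof.
pose s n (l : 'I_K) (y : 'I_K -> R) := n.+1%:R * sin (y l / n.+1%:R).
have Hs n l : multiplier (s n l).
  apply: multiplierM; first exact: multiplier_cst.
  (* A sine of one coordinate is a cosine with frequency 1 / (n + 1) in that coordinate only and
     phase [- (pi / 2)]. *)
  have := multiplier_trig (fun j => if j == l then n.+1%:R^-1 else 0) (- (pi / 2)).
  congr multiplier; apply/funext => y.
  rewrite /trig cosBpihalf (bigD1 l)//= eqxx big1 ?addr0 1?mulrC// => j /negbTE ->.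
  by rewrite mul0r.
have e0 (y : 'I_K -> R) : 0 < \sum_(m < K) expR (y m).
  by rewrite (bigD1 k)//= ltr_wpDr ?expR_gt0// sumr_ge0// => i _; exact: expR_ge0.
have e1 (y : 'I_K -> R) : expR (y k) <= \sum_(m < K) expR (y m).
  by rewrite (bigD1 k)//= lerDl sumr_ge0// => i _; exact: expR_ge0.
apply: (@same_mean_lim (fun n y => normalized_exp (fun l => s n l y) k) _ 1).
- move=> n; apply: multiplier_same_mean; rewrite /normalized_exp; apply: multiplier_div.
  + exact: multiplier_expR.
  + by apply: multiplier_sum => l; exact: multiplier_expR.
  + by move=> y; rewrite ger0_norm ?expR_ge0//; exact: (e1 (fun l => s n l y)).
  + by move=> y; exact: (e0 (fun l => s n l y)).
- move=> n y; rewrite /normalized_exp ger0_norm ?divr_ge0 ?expR_ge0//.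
    by rewrite ler_pdivrMr ?mul1r ?(e1 (fun l => s n l y))//; exact: (e0 (fun l => s n l y)).
  exact: ltW (e0 (fun l => s n l y)).
- move=> y; rewrite /normalized_exp.
  have ce l : expR (s n l y) @[n --> \oo] --> expR (y l).
    by apply: continuous_cvg; [exact: continuous_expR|exact: cvg_sin_scaled].
  apply: cvgM; first exact: ce.
  apply: cvgV; first by rewrite gt_eqF.
  by apply: cvgn_sum => l; exact: ce.
Qed.

End softmax_law.

(** * Invariance of the information efficiency *)

Section measurable_limit.
Local Open Scope classical_set_scope.
Context d (T : measurableType d) (R : realType).

(** The Cauchy criterion makes the convergence set measurable; off it [limn] is constant, so
    altering the sequence there to that constant yields an everywhere convergent sequence with the
    same limit. *)
Lemma measurable_limn (f : nat -> T -> R) :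
  (forall n, measurable_fun setT (f n)) ->
  measurable_fun setT (fun t => limn (f ^~ t)).
Proof.
move=> mf; pose C := [set t | cvgn (f ^~ t)].
have mC : measurable C.
  have -> : C = \bigcap_k \bigcup_N \bigcap_(n in [set n | (N <= n)%N])
      [set t | `|f n t - f N t| <= k.+1%:R^-1].
    apply/seteqP; split => t /=.
      move=> /cvgn_cauchyP H k _; have [N HN] := H k.
      by exists N => // n /= Nn; exact: HN.
    move=> H; apply/cvgn_cauchyP => k; have [N _ HN] := H k I; exists N => n Nn.
    exact: HN.
  apply: bigcapT_measurable => k; apply: bigcupT_measurable => N.
  apply: bigcap_measurable; first by exists N => /=.
  move=> n _; rewrite -[X in measurable X]setTI.
  apply: (measurable_fun_ler (f := fun t => `|f n t - f N t|) (g := cst _)) => //.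
  by apply: measurableT_comp => //; exact: measurable_funB.
(* [limn] is the default point where the sequence diverges. *)
pose p : R := point.
apply: (@measurable_fun_cvg _ _ _ setT (fun n t => \1_C t * (f n t - p) + p)).
  move=> n; apply: measurable_funD => //; apply: measurable_funM.
    exact: measurable_indic.
  exact: measurable_funB.
move=> t _; rewrite /= indicE; case: (pselect (C t)) => Ct.
  rewrite mem_set//=; under eq_fun do rewrite mul1r subrK.
  exact: Ct.
rewrite memNset//=; under eq_fun do rewrite mul0r add0r.
by rewrite (dvgP Ct); exact: cvg_cst.
Qed.

End measurable_limit.

Section partial_sums.
Local Open Scope classical_set_scope.
Context {R : realType} {X : countType}.

Lemma eq_psum (f g : X -> R) : f =1 g -> psum f = psum g.
Proof.
by move=> fg; apply/funext => n; apply: eq_bigr => i _; case: pickle_inv => //= x.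
Qed.

Lemma psumD (f g : X -> R) n : psum (fun x => f x + g x) n = psum f n + psum g n.
Proof.
rewrite /psum -big_split; apply: eq_bigr => i _; case: pickle_inv => //=.
by rewrite addr0.
Qed.

Lemma psum_sumM (I : finType) (c : I -> R) (f : I -> X -> R) n :
  psum (fun x => \sum_i c i * f i x) n = \sum_i c i * psum (f i) n.
Proof.
rewrite /psum; under [RHS]eq_bigr do rewrite mulr_sumr.
rewrite exchange_big; apply: eq_bigr => i _; case: pickle_inv => //=.
by rewrite big1// => j _; rewrite mulr0.
Qed.

End partial_sums.

(** The all-ones matrix J satisfies J^2 = K J, so J / K and its complement are projections; the
    index [k] witnesses that K is not 0. *)
Lemma QmxM {R : realType} K (k : 'I_K) : Qmx R K *m Qmx R K = Qmx R K.
Proof.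
have K0 : (K%:R : R) != 0 by rewrite pnatr_eq0 -lt0n (leq_ltn_trans _ (ltn_ord k)).
pose J : 'M[R]_K := const_mx 1.
have E : J *m J = K%:R *: J.
  apply/matrixP => i j; rewrite !mxE.
  by under eq_bigr do rewrite !mxE mulr1; rewrite sumr_const card_ord mulr1.
rewrite /Qmx -/J mulmxBl mul1mx mulmxBr mulmx1 -scalemxAl -scalemxAr E !scalerA.
by rewrite mulfVK// subrr subr0.
Qed.

Lemma QmxT {R : realType} K : (Qmx R K)^T = Qmx R K.
Proof. by rewrite /Qmx linearB linearZ/= trmx1 trmx_const. Qed.

Lemma Qmx_perm {R : realType} K (s : {perm 'I_K}) i j :
  Qmx R K (s i) (s j) = Qmx R K i j.
Proof. by rewrite !mxE (inj_eq perm_inj). Qed.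

(** * The weighted Gram matrix of the equilibrium demands *)

Section demand_covariance.
Local Open Scope classical_set_scope.
Context {R : realType} (K : nat) (G : trading_game R K) (L Lp : 'M[R]_K) (a : R).
Hypothesis sqrtL : psd_sqrt (gram G) L.
Hypothesis unitL : L \in unitmx.
Hypothesis pinvL : moore_penrose L Lp.
Local Notation W := (@informed_demand R K G a Lp).

Lemma moore_penrose_unit : Lp = invmx L.
Proof.
have [E _ _ _] := pinvL.
have : L *m Lp *m L *m invmx L = L *m invmx L by rewrite E.
rewrite mulmxK// mulmxV// => E1.
by rewrite -[LHS]mul1mx -(mulVmx unitL) -mulmxA E1 mulmx1.
Qed.

(** The limit matrix is a^2 Q L^-1 (gram) L^-1 Q with gram = L^2: the game cancels and a^2 Q^2 = a^2
    Q remains. *)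
Lemma psum_demand_cvg (k l m : 'I_K) :
  psum (fun x : state G => W l x * W m x / sigma x ^+ 2) n @[n --> \oo]
  --> a ^+ 2 * Qmx R K l m.
Proof.
pose B := a *: (Lp *m Qmx R K).
have E n : psum (fun x : state G => W l x * W m x / sigma x ^+ 2) n =
    \sum_i B i l * \sum_j B j m * psum (fun x : state G => Defs.eta i x * Defs.eta j x / sigma x ^+ 2) n.
  under [RHS]eq_bigr do rewrite -psum_sumM.
  rewrite -psum_sumM; congr (_ n); apply: eq_psum => x.
  rewrite /informed_demand mulr_suml mulr_suml; apply: eq_bigr => i _.
  rewrite -!mulrA; congr (_ * _).
  rewrite mulr_suml mulr_sumr; apply: eq_bigr => j _; rewrite -/B; ring.
under eq_fun do rewrite E.
have -> : a ^+ 2 * Qmx R K l m = \sum_i B i l * \sum_j B j m * gram G i j.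
  have BGB : B^T *m gram G *m B = a ^+ 2 *: Qmx R K.
    have [LT _ LL] := sqrtL.
    have BT : B^T = a *: (Qmx R K *m invmx L).
      by rewrite /B moore_penrose_unit linearZ/= trmx_mul QmxT trmx_inv LT.
    rewrite BT -LL /B moore_penrose_unit.
    rewrite -!scalemxAl -scalemxAr scalerA -expr2; congr (_ *: _).
    rewrite !mulmxA (mulmxKV unitL) -(mulmxA _ L) mulmxV// mulmx1.
    exact: QmxM k.
  have -> : a ^+ 2 * Qmx R K l m = (a ^+ 2 *: Qmx R K) l m by rewrite [RHS]mxE.
  rewrite -BGB mxE.
  under eq_bigr do rewrite mxE mulr_suml.
  rewrite exchange_big/=; apply: eq_bigr => i _; rewrite mulr_sumr.
  by apply: eq_bigr => j _; rewrite [B^T l i]mxE; ring.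
apply: cvgn_sum => i; apply: cvgMr; apply: cvgn_sum => j; apply: cvgMr.
by rewrite mxE; exact: gram_finite.
Qed.

End demand_covariance.

(** * The Gaussian law of the log-weights of the posterior *)

Section equilibrium_weights.
Local Open Scope classical_set_scope.
Context {R : realType} (K : nat) (G : trading_game R K) (L Lp : 'M[R]_K) (a : R).
Hypothesis sqrtL : psd_sqrt (gram G) L.
Hypothesis unitL : L \in unitmx.
Hypothesis pinvL : moore_penrose L Lp.
Context d (T : measurableType d) (P : probability T R) (eps : state G -> {RV P >-> R}).
Hypothesis noise : gaussian_noise (@sigma R K G) eps.
Variable k : 'I_K.
Local Notation W := (@informed_demand R K G a Lp).

Definition log_weight_psum (n : nat) (t : T) (l : 'I_K) : R :=
  psum (fun x => W l x * (W k x + eps x t) / sigma x ^+ 2) n -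
  2^-1 * psum (fun x : state G => W l x ^+ 2 / sigma x ^+ 2) n.

Definition log_weight (t : T) (l : 'I_K) : R :=
  csum (fun x => W l x * (W k x + eps x t) / sigma x ^+ 2) -
  2^-1 * csum (fun x : state G => W l x ^+ 2 / sigma x ^+ 2).

Definition log_weight_mean (l : 'I_K) : R :=
  a ^+ 2 * Qmx R K l k - 2^-1 * (a ^+ 2 * Qmx R K l l).

Lemma measurable_psum (f : state G -> T -> R) n :
  (forall x, measurable_fun setT (f x)) ->
  measurable_fun setT (fun t => psum (f ^~ t) n).
Proof.
move=> mf; apply: measurable_sum => i.
by case: pickle_inv => [x|] /=; [exact: mf|exact: measurable_cst].
Qed.

Let mterm l x : measurable_fun setT (fun t => W l x * (W k x + eps x t) / sigma x ^+ 2).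
Proof.
by apply: measurable_funM => //; apply: measurable_funM => //; exact: measurable_funD.
Qed.

Lemma measurable_log_weight_psum n l : measurable_fun setT (fun t => log_weight_psum n t l).
Proof. by apply: measurable_funB => //; exact: measurable_psum. Qed.

Lemma measurable_log_weight l : measurable_fun setT (fun t => log_weight t l).
Proof.
apply: measurable_funB => //; apply: measurable_limn => n; exact: measurable_psum.
Qed.

Let demand_var l :
  psum (fun x : state G => W l x ^+ 2 / sigma x ^+ 2) n @[n --> \oo] --> a ^+ 2 * Qmx R K l l.
Proof. exact: (@psum_demand_cvg _ _ _ _ _ a sqrtL unitL pinvL k l l). Qed.

Lemma log_weight_psumE n t l : log_weight_psum n t l =
  psum (fun x : state G => W l x * W k x / sigma x ^+ 2) n -
  2^-1 * psum (fun x : state G => W l x ^+ 2 / sigma x ^+ 2) n +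
  psum (fun x => W l x / sigma x ^+ 2 * eps x t) n.
Proof.
rewrite /log_weight_psum addrAC -psumD; congr (_ - _); congr (_ n).
by apply: eq_psum => x; ring.
Qed.

Lemma log_weight_psum_ae_cvg :
  {ae P, forall t l, log_weight_psum n t l @[n --> \oo] --> log_weight t l}.
Proof.
have H l : {ae P, forall t, cvgn (psum (fun x => W l x / sigma x ^+ 2 * eps x t))}.
  apply: (noise_series_ae_cvg _ noise); first by move=> x; exact: sigma_gt0.
  apply/cvg_ex; exists (a ^+ 2 * Qmx R K l l).
  (* The noise coefficient is W / sigma^2, so its variance W^2 / sigma^4 * sigma^2 is the summand of
     the squared norm of the demand. *)
  rewrite (_ : psum _ = psum (fun x : state G => W l x ^+ 2 / sigma x ^+ 2)).
    exact: demand_var.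
  by apply: eq_psum => x; field; rewrite gt_eqF// sigma_gt0.
have : {ae P, forall t l, cvgn (psum (fun x => W l x / sigma x ^+ 2 * eps x t))}.
  exact: filter_forall.
apply: filterS => t Ht l.
have c1 : cvgn (psum (fun x => W l x * (W k x + eps x t) / sigma x ^+ 2)).
  have -> : psum (fun x => W l x * (W k x + eps x t) / sigma x ^+ 2) =
    psum (fun x : state G => W l x * W k x / sigma x ^+ 2) \+
    psum (fun x => W l x / sigma x ^+ 2 * eps x t).
    apply/funext => n; rewrite /= -psumD; congr (_ n); apply: eq_psum => x; ring.
  apply: is_cvgD => //.
  exact: (cvgP _ (@psum_demand_cvg _ _ _ _ _ a sqrtL unitL pinvL k l k)).
apply: cvgB; first exact: c1.
by apply: cvgMr; rewrite /csum (cvg_lim _ (@demand_var l)).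
Qed.

(** For each truncation a linear form of the log-weights is a constant plus one noise sum, whose
    cosine has a known mean; the variance is the quadratic form of the truncated Gram matrix. Almost
    sure convergence and the bound 1 on cosines then give the limit. *)
Lemma Rintegral_trig_log_weight (theta : 'I_K -> R) (c : R) :
  (\int[P]_t trig theta c (log_weight t) =
   cos (\sum_l theta l * log_weight_mean l + c) *
   expR (- (\sum_l theta l * (\sum_m theta m * (a ^+ 2 * Qmx R K l m)) / 2)))%R.
Proof.
have mtrig (Z : T -> 'I_K -> R) : (forall l, measurable_fun setT (fun t => Z t l)) ->
    measurable_fun setT (fun t => trig theta c (Z t)).
  move=> mZ; apply: measurableT_comp; first exact: continuous_measurable_fun (@continuous_cos R).
  apply: measurable_funD => //; apply: measurable_sum => l.
  exact: measurable_funM.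
have L1 : (\int[P]_t trig theta c (log_weight_psum n t))%R @[n --> \oo] -->
    (\int[P]_t trig theta c (log_weight t))%R.
  apply: (@Rintegral_bounded_cvg _ _ _ P (fun n t => trig theta c (log_weight_psum n t))
    (fun t => trig theta c (log_weight t)) 1).
  - by move=> n; apply: mtrig => l; exact: measurable_log_weight_psum.
  - by apply: mtrig => l; exact: measurable_log_weight.
  - by move=> n t; exact: cos_max.
  - apply: filterS log_weight_psum_ae_cvg => t Ht; rewrite /trig.
    apply: continuous_cvg; first exact: continuous_cos.
    apply: cvgD; last exact: cvg_cst.
    by apply: cvgn_sum => l; apply: cvgMr; exact: Ht.
(* Coefficients of the single noise series obtained by combining those of all the log-weights; the
   deterministic part [mean n] joins the phase. *)
pose b x := \sum_l theta l * (W l x / sigma x ^+ 2).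
pose mean n := \sum_l theta l * (psum (fun x : state G => W l x * W k x / sigma x ^+ 2) n -
  2^-1 * psum (fun x : state G => W l x ^+ 2 / sigma x ^+ 2) n).
pose var n := \sum_l theta l * \sum_m theta m *
  psum (fun x : state G => W l x * W m x / sigma x ^+ 2) n.
have E n : (\int[P]_t trig theta c (log_weight_psum n t) =
    cos (mean n + c) * expR (- (var n / 2)))%R.
  have := @Rintegral_cos_psum _ _ _ P _ _ _ (@sigma_gt0 R K G) noise b (mean n + c) 1 n.
  rewrite expr1n mul1r => H.
  rewrite -[LHS](_ : (\int[P]_t cos (mean n + c + 1 * psum (fun x => b x * eps x t) n) = _)%R).
    rewrite H; congr (_ * expR (- (_ / 2))).
    rewrite /var; under [RHS]eq_bigr do rewrite -psum_sumM.
    rewrite -psum_sumM; congr (_ n); apply: eq_psum => x.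
    have s0 : sigma x != 0 by rewrite gt_eqF// sigma_gt0.
    have -> : b x ^+ 2 * sigma x ^+ 2 = b x * (b x * sigma x ^+ 2) by ring.
    rewrite {1}/b mulr_suml; apply: eq_bigr => l _.
    rewrite -mulrA; congr (_ * _).
    rewrite /b mulr_suml mulr_sumr; apply: eq_bigr => m _; by field.
  apply: eq_Rintegral => t _; rewrite /trig mul1r addrAC; congr (cos (_ + _)).
  rewrite (_ : psum _ n = \sum_l theta l * psum (fun x => W l x / sigma x ^+ 2 * eps x t) n).
    rewrite -big_split/=; apply: eq_bigr => l _.
    by rewrite -mulrDr -log_weight_psumE.
  rewrite -psum_sumM; congr (_ n); apply: eq_psum => x.
  by rewrite /b mulr_suml; apply: eq_bigr => l _; ring.
have L2 : cos (mean n + c) * expR (- (var n / 2)) @[n --> \oo] -->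
   cos (\sum_l theta l * log_weight_mean l + c) *
   expR (- ((\sum_l theta l * (\sum_m theta m * (a ^+ 2 * Qmx R K l m))) / 2)).
  apply: cvgM.
    apply: continuous_cvg; first exact: continuous_cos.
    apply: cvgD; last exact: cvg_cst.
    apply: cvgn_sum => l; apply: cvgMr; apply: cvgB.
      exact: (@psum_demand_cvg _ _ _ _ _ a sqrtL unitL pinvL k l k).
    by apply: cvgMr; exact: demand_var.
  apply: continuous_cvg; first exact: continuous_expR.
  apply: cvgN; apply: cvgMl; apply: cvgn_sum => l; apply: cvgMr.
  apply: cvgn_sum => m; apply: cvgMr; exact: (@psum_demand_cvg _ _ _ _ _ a sqrtL unitL pinvL k l m).
have {}E : (fun n => \int[P]_t trig theta c (log_weight_psum n t))%R =
  (fun n => cos (mean n + c) * expR (- (var n / 2))) by apply/funext.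
rewrite E in L1; rewrite (cvg_unique _ L1 L2)//.
by rewrite mulr_suml.
Qed.

Lemma info_efficiencyE : info_efficiency a Lp eps k =
  (\int[P]_t normalized_exp (log_weight t) k)%R%:E.
Proof.
(* Comparing the law with itself yields the boundedness and measurability of the softmax, hence a
   finite expectation. *)
have Hsame := @same_mean_softmax R K _ _ P log_weight _ _ P log_weight
  measurable_log_weight measurable_log_weight (fun _ _ => erefl) k.
have [[M bM] mf _ _] := Hsame.
rewrite /info_efficiency unlock /Rintegral fineK//.
apply: integrable_fin_num => //.
exact: (@bounded_integrable _ _ _ P _ M mf (fun t => bM (log_weight t))).
Qed.

End equilibrium_weights.

Section invariance.
Context {R : realType} (K : nat) (a : R).

Lemma info_efficiency_invariant (G G' : trading_game R K) (L Lp L' Lp' : 'M[R]_K)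
    (d : measure_display) (T : measurableType d) (P : probability T R)
    (eps : state G -> {RV P >-> R})
    (d' : measure_display) (T' : measurableType d') (P' : probability T' R)
    (eps' : state G' -> {RV P' >-> R}) (k k' : 'I_K) :
  psd_sqrt (gram G) L -> L \in unitmx -> moore_penrose L Lp ->
  psd_sqrt (gram G') L' -> L' \in unitmx -> moore_penrose L' Lp' ->
  gaussian_noise (@sigma R K G) eps -> gaussian_noise (@sigma R K G') eps' ->
  info_efficiency a Lp eps k = info_efficiency a Lp' eps' k'.
Proof.
move=> sL uL pL sL' uL' pL' noise noise'.
rewrite !info_efficiencyE; congr (_%:E).
(* Relabelling the signals of the second game by [s] moves the realized signal from [k'] to [k];
   means and covariances match because the entries of Q are invariant under simultaneous permutation
   of rows and columns. *)
pose s := tperm k k'.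
pose Z t := log_weight Lp a eps k t.
pose Z' t l := log_weight Lp' a eps' k' t (s l).
have mZ l : measurable_fun setT (fun t => Z t l) by exact: measurable_log_weight.
have mZ' l : measurable_fun setT (fun t => Z' t l) by exact: measurable_log_weight.
have trigZ theta c : (\int[P]_t trig theta c (Z t) = \int[P']_t trig theta c (Z' t))%R.
  have sK : involutive s := tpermK k k'.
  rewrite [LHS](Rintegral_trig_log_weight a sL uL pL noise).
  have := Rintegral_trig_log_weight a sL' uL' pL' noise' k' (theta \o s) c.
  rewrite (_ : (\int[P']_t _)%R = (\int[P']_t trig theta c (Z' t))%R) => [->|]; last first.
    apply: eq_Rintegral => t _; congr (cos (_ + _)).
    rewrite (reindex_inj (@perm_inj _ s))/=; apply: eq_bigr => l _.
    by rewrite sK.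
  congr (cos (_ + _) * expR (- _)); rewrite [RHS](reindex_inj (@perm_inj _ s))/=.
    apply: eq_bigr => l _; rewrite sK; congr (_ * _).
    by rewrite /log_weight_mean -(Qmx_perm s l k) -(Qmx_perm s l l) tpermL.
  apply: eq_bigr => l _; rewrite sK; congr (_ * _ / _).
  rewrite [RHS](reindex_inj (@perm_inj _ s))/=; apply: eq_bigr => m _.
  by rewrite sK Qmx_perm.
have [_ _ _ ->] := @same_mean_softmax R K _ _ P Z _ _ P' Z' mZ mZ' trigZ k.
apply: eq_Rintegral => t _; rewrite /normalized_exp /Z' tpermL; congr (_ / _).
by rewrite [RHS](reindex_inj (@perm_inj _ s)).
Qed.

End invariance.

Theorem corollary7p9 (R : realType) (alphastar : nat -> R) :
  (* (i) *)
  (exists F : nat -> R,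
    forall (K : nat), canonical_scale K (alphastar K) ->
    forall (G : trading_game R K) (L Lp : 'M[R]_K),
      psd_sqrt (gram G) L -> L \in unitmx -> moore_penrose L Lp ->
    forall (d : measure_display) (Omega : measurableType d)
      (P : probability Omega R) (eps : state G -> {RV P >-> R}),
      gaussian_noise (@sigma R K G) eps ->
    forall k : 'I_K,
      info_efficiency (alphastar K) Lp eps k = (F K)%:E) /\
  (* (ii) *)
  (forall (K : nat), canonical_scale K (alphastar K) ->
    forall (G G' : trading_game R K) (L Lp L' Lp' : 'M[R]_K),
      psd_sqrt (gram G) L -> L \in unitmx -> moore_penrose L Lp ->
      psd_sqrt (gram G') L' -> L' \in unitmx -> moore_penrose L' Lp' ->
    forall (d : measure_display) (Omega : measurableType d)
      (P : probability Omega R) (eps : state G -> {RV P >-> R})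
      (d' : measure_display) (Omega' : measurableType d')
      (P' : probability Omega' R) (eps' : state G' -> {RV P' >-> R}),
      gaussian_noise (@sigma R K G) eps ->
      gaussian_noise (@sigma R K G') eps' ->
    forall k : 'I_K,
      info_efficiency (alphastar K) Lp eps k =
      info_efficiency (alphastar K) Lp' eps' k).
Proof.
split; last first.
  move=> K _ G G' L Lp L' Lp' sL uL pL sL' uL' pL' d T P eps d' T' P' eps' noise noise' k.
  exact: (info_efficiency_invariant _ _ _ sL uL pL sL' uL' pL').
(* [F] must be fixed before any game is given. By invariance at most one value is attained for each
   [K], and choice collects these values into a function. *)
pose attained K r := exists (G : trading_game R K) (L Lp : 'M[R]_K)
  (d : measure_display) (T : measurableType d) (P : probability T R)
  (eps : state G -> {RV P >-> R}) (k : 'I_K),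
  [/\ psd_sqrt (gram G) L, L \in unitmx, moore_penrose L Lp,
      gaussian_noise (@sigma R K G) eps & info_efficiency (alphastar K) Lp eps k = r%:E].
suff H K : exists r, forall r', attained K r' -> r' = r.
  have [F FP] := choice H; exists F => K _ G L Lp sL uL pL d T P eps noise k.
  rewrite info_efficiencyE; congr (_%:E); apply: FP.
  exists G, L, Lp, d, T, P, eps, k; split => //; exact: info_efficiencyE.
have [[r [G [L [Lp [d [T [P [eps [k [sL uL pL noise E]]]]]]]]]]|none] :=
    pselect (exists r, attained K r); last first.
  (* Default value when no efficiency is attained, for instance at K = 0, where there is no
     signal. *)
  by exists 0 => r' Hr'; exfalso; apply: none; exists r'.
exists r => r' [G' [L' [Lp' [d' [T' [P' [eps' [k' [sL' uL' pL' noise' E']]]]]]]]].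
apply: EFin_inj; rewrite -E -E'.
exact: (info_efficiency_invariant _ _ _ sL' uL' pL' sL uL pL).
Qed.
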